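(* Let $q$ be a prime power and let $f\in\mathbb{F}_q[T][X]$ be irreducible with $d=\deg_X f\ge 2$. Then, as $n\to\infty$, $$\deg \ell_f(n)\sim \deg L_f(n).$$
   Context: $M_n$ denotes the set of monic polynomials of degree $n$ in $\mathbb{F}_q[T]$. For $n$ large enough that $f(Q)\neq 0$ for all $Q\in M_n$, set $L_f(n)=\mathrm{lcm}(f(Q):Q\in M_n)$ and $\ell_f(n)=\mathrm{rad}\,L_f(n)$ (the product of the distinct monic primes dividing $L_f(n)$); $\deg$ is degree in $T$. $A\sim B$ means $A(n)/B(n)\to 1$. *)

(* Defs.v *)
From HB Require Import structures.
From mathcomp Require Import all_boot all_order all_algebra all_field.
From mathcomp Require Import all_classical all_reals all_analysis.
Set Implicit Arguments.
Unset Strict Implicit.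
Unset Printing Implicit Defensive.
Import Order.TTheory GRing.Theory Num.Theory.
Import numFieldNormedType.Exports.
Local Open Scope ring_scope.

(* Irreducibility in the ring R itself. For a polynomial ring over a ring that
   is not a field this is stronger than [irreducible_poly], whose divisibility
   [%|] ignores constant factors; in F[T][X] it also forces primitivity. *)
Definition irreducible_elt (R : idomainType) (x : R) : Prop :=
  [/\ x != 0, x \isn't a GRing.unit &
      forall a b : R, x = a * b ->
        a \is a GRing.unit \/ b \is a GRing.unit].

Definition pdeg (F : fieldType) (p : {poly F}) : nat := (size p).-1.

Definition lcmp (F : fieldType) (p r : {poly F}) : {poly F} :=
  (p * r) %/ gcdp p r.

(* The variable X of f is the outer one and T is the inner one, so that
   f.[Q] is the value f(Q) in F[T]. *)
Definition lcm_values (F : finFieldType) (f : {poly {poly F}}) (n : nat) :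
    {poly F} :=
  \big[@lcmp F/1]_(Q : {poly_(n.+1) F}
      | (polyn Q \is monic) && (pdeg (polyn Q) == n)) f.[polyn Q].

(* A prime dividing a nonzero A has size at most [size A]. *)
Definition rad (F : finFieldType) (A : {poly F}) : {poly F} :=
  \prod_(P : {poly_(size A) F}
      | [&& polyn P \is monic, irreducibleb (polyn P) & polyn P %| A]) polyn P.

Definition rad_lcm_values (F : finFieldType) (f : {poly {poly F}}) (n : nat) :
    {poly F} :=
  rad (lcm_values f n).

Definition asymp_equiv (R : realType) (a b : nat -> nat) : Prop :=
  ((fun n => (a n)%:R / (b n)%:R : R) @ \oo --> (1 : R))%classic.

Lemma lcmp_dvd (F : fieldType) (p r m : {poly F}) :
  (lcmp p r %| m) = (p %| m) && (r %| m).
Proof.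
rewrite /lcmp; have [->|p0] := eqVneq p 0.
  rewrite mul0r div0p dvd0p; have [->|m0] := eqVneq m 0; rewrite ?dvdp0 //.
have g0 : gcdp p r != 0 by rewrite gcdp_eq0 (negPf p0).
have gpr : gcdp p r %| p * r by rewrite dvdp_mull ?dvdp_gcdr.
rewrite -(dvdp_mul2r (p * r %/ gcdp p r) m g0) divpK //.
rewrite (eqp_dvdr _ (mulp_gcdr p r m)) dvdp_gcd.
have [->|r0] := eqVneq r 0.
  rewrite !mulr0 !dvd0p eqxx andbT mulf_eq0 (negPf p0) orbF.
  by have [->|] := eqVneq m 0; rewrite ?dvdp0 ?andbF.
by rewrite dvdp_mul2r // mulrC dvdp_mul2r // andbC.
Qed.

Lemma lcm_values_dvd (F : finFieldType) (f : {poly {poly F}}) n (m : {poly F}) :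
  (lcm_values f n %| m) <->
  (forall Q : {poly F}, Q \is monic -> pdeg Q = n -> f.[Q] %| m).
Proof.
have mL : {morph (fun p => p %| m) : p r / lcmp p r >-> p && r}.
  by move=> p r; exact: lcmp_dvd.
rewrite /lcm_values (big_morph _ mL (dvd1p m)).
rewrite big_all_cond; split=> [/allP H Q mQ sQ|H].
  have sQ1 : Q \is a poly_of_size n.+1.
    by rewrite qualifE /= -sQ /pdeg; case: (size Q).
  have := H (NPoly sQ1) (mem_index_enum _).
  by rewrite /= mQ sQ eqxx.
by apply/allP => Q _; apply/implyP => /andP[mQ /eqP sQ]; exact: H.
Qed.

Lemma rad_dvd (F : finFieldType) (A P : {poly F}) :
  A != 0 -> irreducible_poly P -> (P %| rad A) = (P %| A).
Proof.
move=> A0 irrP; apply/idP/idP.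
  rewrite /rad; elim/big_rec: _ => [|Q p /and3P[mQ /irreducibleP irrQ QA] IH].
    by rewrite dvdp1 => /eqP sP; have := irrP.1; rewrite sP.
  have [PQ _|nPQ] := boolP (P %| polyn Q); first exact: dvdp_trans PQ QA.
  by rewrite Gauss_dvdpr // irreducible_poly_coprime.
move=> PA; have P0 : P != 0 by apply/eqP => p0; have := irrP.1; rewrite p0 size_poly0.
set c := (lead_coef P)^-1.
have c0 : c != 0 by rewrite invr_eq0 lead_coef_eq0.
have sP : c *: P \is a poly_of_size (size A).
  by rewrite qualifE /= size_scale // dvdp_leq.
rewrite /rad (bigD1 (NPoly sP)) /=; last first.
  apply/and3P; split.
  - by rewrite monicE lead_coefZ mulVf // lead_coef_eq0.
  - apply/irreducibleP; split=> [|q sq]; first by rewrite size_scale ?irrP.1.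
    rewrite (eqp_dvdr _ (eqp_scale P c0)) => /(irrP.2 _ sq) qP.
    by rewrite (eqp_trans qP) // eqp_sym eqp_scale.
  - by rewrite dvdpZl.
by rewrite dvdp_mulr // dvdpZr.
Qed.

(* Main.v *)
(* Let q = #|F|, d = deg_X f, L = L_f(n), and write P for monic primes of F[T].
   The degree of A is the sum of deg P over all prime powers P^k, k >= 1,
   dividing A, so deg L - deg (rad L) only involves primes with P^2 | L, and each
   of them contributes at most d n + O(1).

   There are o(q^n) primes of degree at most n. If deg P > n and P^2 | f(Q), then
   P divides the T-derivative of f(Q), hence the resultant in X of f and
   f_T + Q' f_X. This resultant has degree O(n) and depends on Q' only; in
   characteristic p the derivative takes at most q^(n - n/p) values on M_n, and
   the resultant vanishes for at most one value of Q'. So o(q^n) primes satisfy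
   P^2 | L, and it remains to see that n q^n = O(deg L).

   Sum deg f(Q) over Q in M_n: the total is about d n q^n. A prime of degree
   greater than n divides at most d of the values, so those primes account for at
   most d deg L. The primes of degree at most n account for the sum of
   rho(P) deg P q^(n - deg P), up to O(q^n) + o(n q^n), where rho(P) is the number
   of roots of f modulo P. This sum is at most q^n (n + O(1)): let alpha range over
   the polynomials in X of degree less than d with coefficients of degree less
   than H, where d H is about n. The resultant of f and alpha has degree at most
   d H + O(1) and is divisible by P^s as soon as f and alpha have s common roots
   modulo P, while for each root r of f modulo P at least q^(d H - deg P) of the
   alpha vanish at r modulo P. As d >= 2, this leaves (d - 1) n q^n for d deg L. *)
Require Import Defs.
From HB Require Import structures.
From mathcomp Require Import all_boot all_order all_algebra all_field.
From mathcomp Require Import all_classical all_reals all_analysis.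
From mathcomp Require Import zify ring.
Set Implicit Arguments.
Unset Strict Implicit.
Unset Printing Implicit Defensive.
Import Order.TTheory GRing.Theory Num.Theory.
Local Open Scope ring_scope.

(* The size of a polynomial may be stated through different paths of
   the ring hierarchy; this identifies the convertible ones before [lia]. *)
Ltac slia :=
  intros; unfold pdeg in *;
  repeat match goal with
  | |- context [@size ?T ?A] =>
    let s := fresh "s" in
    pose (s := @size T A);
    repeat match goal with
    | |- context [@size ?T' ?A'] =>
      change (@size T' A') with s
    | H : context [@size ?T' ?A'] |- _ =>
      lazymatch H with s => fail | _ => idtac end;
      change (@size T' A') with s in H
    end; clearbody s
  | H : context [@size ?T ?A] |- _ =>
    let s := fresh "s" in
    pose (s := @size T A);
    repeat match goal with
    | H' : context [@size ?T' ?A'] |- _ =>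
      lazymatch H' with s => fail | _ => idtac end;
      change (@size T' A') with s in H'
    end; clearbody s
  end; lia.

(** * Prime polynomials and prime power divisors *)

Section PrimePolynomials.
Variable F : finFieldType.
Implicit Types (A B P Q : {poly F}) (k n : nat).

Lemma pdegM A B : A != 0 -> B != 0 -> pdeg (A * B) = (pdeg A + pdeg B)%N.
Proof.
move=> A0 B0; rewrite /pdeg size_mul //.
by rewrite (polySpred A0) (polySpred B0) /= addnS.
Qed.

Lemma pdegX A k : pdeg (A ^+ k) = (k * pdeg A)%N.
Proof. by rewrite /pdeg size_exp mulnC. Qed.

Lemma pdeg_dvd A B : B != 0 -> A %| B -> (pdeg A <= pdeg B)%N.
Proof.
by move=> B0 /(dvdp_leq B0); slia.
Qed.

Lemma pdeg_prod (I : Type) (r : seq I) (p : pred I) (G : I -> {poly F}) :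
  (forall i, p i -> G i != 0) ->
  pdeg (\prod_(i <- r | p i) G i) = (\sum_(i <- r | p i) pdeg (G i))%N.
Proof.
move=> G0; suff [] : pdeg (\prod_(i <- r | p i) G i) =
    (\sum_(i <- r | p i) pdeg (G i))%N /\ \prod_(i <- r | p i) G i != 0 by [].
apply: (big_ind2 (fun x y => pdeg x = y /\ x != 0)).
- by rewrite /pdeg size_poly1 oner_neq0.
- by move=> x1 x2 y1 y2 [<- x0] [<- y0]; rewrite pdegM // mulf_neq0.
- by move=> i /G0.
Qed.

Lemma irredp_deg_gt0 P : irreducible_poly P -> (0 < pdeg P)%N.
Proof. by case; slia. Qed.

Lemma irredp_prime P A B : irreducible_poly P ->
  (P %| A * B) = (P %| A) || (P %| B).
Proof.
move=> irrP; have [PA|nPA] /= := boolP (P %| A); first by rewrite dvdp_mulr.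
by rewrite Gauss_dvdpr // irreducible_poly_coprime.
Qed.

Lemma irredp_prime_pow P A k : irreducible_poly P -> P %| A ^+ k -> P %| A.
Proof.
move=> irrP; elim: k => [|k IH]; last by rewrite exprS irredp_prime // => /orP[].
by rewrite expr0 dvdp1 => /eqP sP; have := irrP.1; rewrite sP.
Qed.

Definition prime_polys n : seq {poly F} :=
  [seq polyn p | p <- enum {: {poly_n.+1 F}} &
     (polyn p \is monic) && irreducibleb (polyn p)].

Lemma mem_prime_polys n P :
  (P \in prime_polys n) = [&& P \is monic, irreducibleb P & pdeg P <= n]%N.
Proof.
apply/mapP/and3P => [[Q] | [mP iP dP]].
  rewrite mem_filter => /andP[/andP[mQ iQ] _ ->]; split => //.
  by have := size_npoly Q; slia.
have sP : P \is a poly_of_size n.+1 by rewrite qualifE /=; slia.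
by exists (NPoly sP) => //; rewrite mem_filter mP iP mem_enum.
Qed.

Lemma prime_polys_uniq n : uniq (prime_polys n).
Proof.
rewrite map_inj_uniq => [|p r pr]; last exact: val_inj.
by apply: filter_uniq; exact: enum_uniq.
Qed.

Lemma prime_polysP n P : P \in prime_polys n ->
  [/\ P \is monic, irreducible_poly P, P != 0 & (0 < pdeg P <= n)%N].
Proof.
rewrite mem_prime_polys => /and3P[mP /irreducibleP iP dP]; split=> //.
  exact: monic_neq0.
by rewrite dP irredp_deg_gt0.
Qed.

Lemma prime_polys_le m n : (m <= n)%N ->
  perm_eq (prime_polys m) [seq P <- prime_polys n | pdeg P <= m]%N.
Proof.
move=> mn; apply: uniq_perm; rewrite ?filter_uniq ?prime_polys_uniq // => P.
rewrite mem_filter !mem_prime_polys; case: (_ \is monic) => //=; last by rewrite andbF.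
by case: irreducibleb => //=; rewrite ?andbF //; lia.
Qed.

Lemma sum_prime_polys_le m n (G : {poly F} -> nat) : (m <= n)%N ->
  (\sum_(P <- prime_polys m) G P = \sum_(P <- prime_polys n | pdeg P <= m) G P)%N.
Proof. by move=> mn; rewrite (perm_big _ (prime_polys_le mn)) /= big_filter. Qed.

Lemma irredp_monic_eq P Q : P \is monic -> Q \is monic -> irreducible_poly P ->
  irreducible_poly Q -> P %| Q -> P = Q.
Proof.
move=> mP mQ iP iQ PQ; apply/eqP; rewrite -eqp_monic //.
by apply: iQ.2 => //; have := iP.1; case: (size P) => [|[]].
Qed.

Lemma exists_prime_dvd A : (1 < size A)%N ->
  exists2 P, (P \is monic) && irreducibleb P & P %| A.
Proof.
have [m] := ubnP (size A); elim: m A => // m IH A Am A1.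
have [/irreducibleP irrA|/irreducibleP nirr] := boolP (irreducibleb A).
  have A0 : A != 0 by rewrite -size_poly_gt0; slia.
  have c0 : (lead_coef A)^-1 != 0 by rewrite invr_eq0 lead_coef_eq0.
  exists ((lead_coef A)^-1 *: A); last by rewrite dvdpZl.
  rewrite monicE lead_coefZ mulVf ?lead_coef_eq0 // eqxx /=.
  apply/irreducibleP; split=> [|B sB]; first by rewrite size_scale.
  rewrite (eqp_dvdr _ (eqp_scale A c0)) => /(irrA.2 _ sB) BA.
  by rewrite (eqp_trans BA) // eqp_sym eqp_scale.
have [B [sB BA nBA]] : exists B, [/\ size B != 1%N, B %| A & ~~ (B %= A)].
  apply: contra_notP nirr => H; split=> // B sB BA; apply: contra_notT H => nBA.
  by exists B.
have A0 : A != 0 by rewrite -size_poly_gt0; slia.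
have sBA : (size B < size A)%N.
  rewrite ltn_neqAle dvdp_leq // andbT; apply: contra nBA => sz.
  by rewrite -dvdp_size_eqp.
have B0 : B != 0 by apply: contraTneq BA => ->; rewrite dvd0p.
case: (IH B) => [||P mi PB]; [lia| |].
  by rewrite -size_poly_gt0 in B0; slia.
by exists P => //; apply: dvdp_trans PB BA.
Qed.

Lemma dvdp_pow_deg P A k : A != 0 -> P ^+ k %| A -> (k * pdeg P <= pdeg A)%N.
Proof. by move=> A0 /(pdeg_dvd A0); rewrite pdegX. Qed.

(** Induction on deg A: splitting off a prime, A = P0 C, shifts the exponents at P0 by one and
    changes none at the other primes. The bounds m, n >= deg A ensure that no prime power divisor of
    A is cut off. *)
Lemma pdeg_prime_powers A m n : A != 0 -> (pdeg A <= m)%N -> (pdeg A <= n)%N ->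
  pdeg A = (\sum_(P <- prime_polys m) \sum_(k < n) (P ^+ k.+1 %| A)%R * pdeg P)%N.
Proof.
have [s] := ubnP (pdeg A); elim: s A => // s IH A As A0 Am An.
have [A1|A1] := leqP (size A) 1.
  rewrite [LHS](_ : _ = 0%N); last by slia.
  rewrite big_seq big1 // => P /prime_polysP[_ _ _ dP]; rewrite big1 // => k _.
  case: (boolP (_ %| _)) => [/(dvdp_pow_deg A0)|//].
  by slia.
have [P0 mi PA] := exists_prime_dvd A1.
have {mi} [mP0 irr0] : P0 \is monic /\ irreducible_poly P0.
  by case/andP: mi => ? /irreducibleP.
have P00 : P0 != 0 by exact: monic_neq0.
pose C := A %/ P0; have AE : A = P0 * C by rewrite mulrC divpK.
have C0 : C != 0 by apply: contraNneq A0 => c0; rewrite AE c0 mulr0.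
have dA : pdeg A = (pdeg P0 + pdeg C)%N by rewrite AE pdegM.
have d0 := irredp_deg_gt0 irr0.
have P0m : P0 \in prime_polys m.
  by rewrite mem_prime_polys mP0 /=; apply/andP; split; [exact/irreducibleP|lia].
rewrite {1}dA (IH C) //; try lia.
rewrite !(bigD1_seq P0) ?prime_polys_uniq //= addnA; congr (_ + _)%N.
  case: n An {IH} => [|n] An; first lia.
  rewrite [RHS]big_ord_recl big_ord_recr /= expr1 PA mul1n; congr (_ + _)%N.
  rewrite (_ : (P0 ^+ n.+1 %| C) = false) ?mul0n ?addn0.
    apply: eq_bigr => k _; rewrite /bump /= add1n AE [P0 ^+ k.+2]exprS.
    by rewrite dvdp_mul2l.
  by apply/negbTE; apply/negP => /(dvdp_pow_deg C0); nia.
rewrite big_seq_cond [RHS]big_seq_cond; apply: eq_bigr => P /andP[/prime_polysP[mP irrP _ _] PP0].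
apply: eq_bigr => k _; congr (nat_of_bool _ * _)%N.
rewrite AE Gauss_dvdpr // coprimep_expl // irreducible_poly_coprime //.
by apply: contra PP0 => PP0; rewrite (irredp_monic_eq mP mP0).
Qed.

Lemma pdeg_prime_powers_le A m n (p : pred {poly F}) : A != 0 ->
  (\sum_(P <- prime_polys m | p P) \sum_(k < n) (P ^+ k.+1 %| A)%R * pdeg P <= pdeg A)%N.
Proof.
move=> A0; pose m' := maxn m (pdeg A); pose n' := maxn n (pdeg A).
rewrite (pdeg_prime_powers (m := m') (n := n') A0) ?leq_maxr //.
apply: (@leq_trans (\sum_(P <- prime_polys m) \sum_(k < n) (P ^+ k.+1 %| A)%R * pdeg P)).
  by rewrite [leqRHS](bigID p) /= leq_addr.
rewrite (@sum_prime_polys_le m m') ?leq_maxl // [leqRHS](bigID (fun P => pdeg P <= m)%N) /=.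
apply: leq_trans (leq_addr _ _); apply: leq_sum => P _.
rewrite (big_ord_widen n' (fun k => (P ^+ k.+1 %| A)%R * pdeg P)%N) ?leq_maxl //.
by rewrite [leqRHS](bigID (fun k : 'I_n' => k < n)%N) leq_addr.
Qed.

Lemma sum_prime_dvd_le A m (p : pred {poly F}) : A != 0 ->
  (\sum_(P <- prime_polys m | p P && (P %| A)%R) pdeg P <= pdeg A)%N.
Proof.
move=> A0; apply: leq_trans (@pdeg_prime_powers_le A m 1 p A0).
rewrite big_mkcondr /=; apply: leq_sum => P _.
by rewrite big_ord1 expr1; case: (P %| A); rewrite ?mul1n.
Qed.

End PrimePolynomials.

(** * Residue fields and prime counting *)

Section ResidueField.
Variables (F : finFieldType) (P : {poly F}).
Hypothesis miP : monic_irreducible_poly P.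
Let K := {poly %/ P with miP}.
Implicit Types A B : {poly F}.

Definition residue A : K := in_qpoly P A.

Lemma residue_is_zmod_morphism : zmod_morphism residue.
Proof. by move=> A B; rewrite /residue rmorphB. Qed.

Lemma residue_is_monoid_morphism : monoid_morphism residue.
Proof. by split=> [|A B]; rewrite /residue ?rmorph1 ?rmorphM. Qed.

HB.instance Definition _ :=
  GRing.isZmodMorphism.Build {poly F} K residue residue_is_zmod_morphism.
HB.instance Definition _ :=
  GRing.isMonoidMorphism.Build {poly F} K residue residue_is_monoid_morphism.

Lemma residue_eq0 A : (residue A == 0) = (P %| A).
Proof.
have mP : P \is monic by case: miP.
apply/eqP/idP => [/val_eqP /= | PA].
  by rewrite -Pdiv.IdomainMonic.modpE mk_monicE.
by apply/val_eqP; rewrite /= -Pdiv.IdomainMonic.modpE mk_monicE.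
Qed.

(** The residue field has q^(deg P) elements, so each of them, in particular the class of T, is
    fixed by raising to that power. *)
Lemma dvd_Xq_sub_X : P %| 'X^(#|F| ^ pdeg P) - 'X.
Proof.
rewrite -residue_eq0 rmorphB rmorphXn /= subr_eq0; apply/eqP.
by rewrite -[in LHS](card_qfpoly miP) expf_card.
Qed.

End ResidueField.

Section PrimeCounting.
Variable F : finFieldType.
Implicit Types (P : {poly F}) (m n : nat).
Local Notation q := #|F|.

Lemma card_field_gt1 : (1 < q)%N.
Proof. exact: finRing_gt1. Qed.

(** For m >= 1, primes of degree m are distinct divisors of T^(q^m) - T, whose degree is q^m. *)
Lemma sum_pdeg_primes_eq m n :
  (\sum_(P <- prime_polys F n | pdeg P == m) pdeg P <= q ^ m)%N.
Proof.
case: m => [|m].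
  by rewrite big1 // => P /eqP.
pose A : {poly F} := 'X^(q ^ m.+1) - 'X.
have q1 := card_field_gt1.
have qm : (1 < q ^ m.+1)%N by rewrite -(exp1n m.+1) ltn_exp2r.
have sA : size A = (q ^ m.+1).+1.
  by rewrite size_polyDl size_polyXn // size_polyN size_polyX.
have A0 : A != 0 by rewrite -size_poly_gt0 sA.
apply: (@leq_trans (pdeg A)); last by rewrite /pdeg sA.
apply: leq_trans (sum_prime_dvd_le n (fun P => pdeg P == m.+1) A0).
rewrite big_seq_cond [leqRHS]big_seq_cond eq_leq //; apply: eq_bigl => P.
have [/prime_polysP[mP irrP _ _]|//] := boolP (P \in _) => /=.
have [/eqP dP|//] := boolP (_ == _) => /=; apply/esym.
by rewrite /A -dP; apply: dvd_Xq_sub_X.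
Qed.

Lemma sum_pdeg_primes n : (\sum_(P <- prime_polys F n) pdeg P <= q ^ n.+1)%N.
Proof.
elim: n => [|n IH].
  by rewrite big_seq big1 // => P /prime_polysP[_ _ _]; lia.
rewrite (bigID (fun P => pdeg P <= n)%N) /= -sum_prime_polys_le //.
apply: (@leq_trans (q ^ n.+1 + q ^ n.+1)).
  apply: leq_add IH _; apply: leq_trans (sum_pdeg_primes_eq n.+1 n.+1).
  rewrite big_seq_cond [leqRHS]big_seq_cond eq_leq //; apply: eq_bigl => P.
  by have [/prime_polysP[_ _ _]|//] := boolP (P \in _); lia.
by rewrite addnn -mul2n [leqRHS]expnS leq_mul2r card_field_gt1 orbT.
Qed.

(** A prime of degree above m0 takes up more than m0 of the total degree q^(n+1) allowed by
    [sum_pdeg_primes]. With m0 = 2qe there are few of them, and the c primes of degree at most m0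
    are absorbed once n >= m0 c. *)
Lemma prime_polys_negligible (e : nat) : exists N, forall n, (N <= n)%N ->
  (e * size (prime_polys F n) <= q ^ n)%N.
Proof.
have q1 := card_field_gt1.
pose m0 := (2 * q * e)%N; pose c := size (prime_polys F m0).
exists (m0 * c)%N => n Nn.
have key : (m0 * size (prime_polys F n) <= m0 * c + q ^ n.+1)%N.
  apply: leq_trans (leq_add (leqnn _) (sum_pdeg_primes n)).
  have [nm0|m0n] := leqP n m0.
    apply: leq_trans (leq_addr _ _); rewrite leq_mul2l; apply/orP; right.
    by rewrite (perm_size (prime_polys_le F nm0)) size_filter count_size.
  rewrite /c (perm_size (prime_polys_le F (ltnW m0n))) size_filter -sum1_count -sum1_size.
  rewrite !big_distrr /= [leqLHS](bigID (fun P => pdeg P <= m0)%N) /= leq_add2l muln1.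
  rewrite [leqRHS](bigID (fun P => pdeg P <= m0)%N) /=.
  apply: leq_trans (leq_addl _ _); apply: leq_sum => P; rewrite -ltnNge ?muln1.
  exact: ltnW.
have nq : (n < q ^ n)%N by apply: ltn_expl.
have : (2 * q * (e * size (prime_polys F n)) <= 2 * q * q ^ n)%N.
  by rewrite mulnA -/m0 (leq_trans key) // expnS; nia.
by rewrite leq_pmul2l //; lia.
Qed.

End PrimeCounting.

(** * Roots modulo a prime *)

Section RootsModulo.
Variable F : finFieldType.
Implicit Types (P : {poly F}) (f : {poly {poly F}}).

Definition nroots_mod f P : nat :=
  #|[pred r : {poly_(pdeg P) F} | P %| f.[polyn r]]|.

Lemma small_congr_eq P (A B : {poly F}) : (size A <= pdeg P)%N ->
  (size B <= pdeg P)%N -> P %| A - B -> A = B.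
Proof.
move=> sA sB PAB; apply/eqP; rewrite -subr_eq0; apply: contraTT PAB => AB0.
apply/negP => /(dvdp_leq AB0); have := size_polyD A (- B); rewrite size_polyN.
have := AB0; rewrite -size_poly_gt0; slia.
Qed.

Lemma nroots_mod_leq f P : P \is monic -> irreducible_poly P ->
  ~~ (P %| lead_coef f) -> (nroots_mod f P <= (size f).-1)%N.
Proof.
move=> mP iP nPl; pose miP : monic_irreducible_poly P := conj iP mP.
pose g := map_poly (residue miP) f.
have g0 : g != 0.
  apply: contraNneq nPl => g0; rewrite -(residue_eq0 miP) /lead_coef.
  by rewrite -(coef_map (residue miP)) -/g g0 coef0.
rewrite /nroots_mod cardE; set s := enum _.
have all_r : all (root g) [seq residue miP (polyn r) | r <- s].
  apply/allP => x /mapP[r]; rewrite mem_enum inE => Pr ->.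
  by rewrite rootE horner_map residue_eq0.
have uniq_r : uniq [seq residue miP (polyn r) | r <- s].
  rewrite map_inj_uniq ?enum_uniq // => r t /eqP.
  rewrite -subr_eq0 -rmorphB residue_eq0 => rt.
  by apply/val_inj/(small_congr_eq _ _ rt); apply: size_npoly.
have := leq_trans (max_poly_roots g0 all_r uniq_r) (size_poly _ _).
by rewrite size_map; slia.
Qed.

End RootsModulo.

(** * Gauss lemma and resultants *)

Section GaussLemma.
Variable F : finFieldType.
Implicit Types (P : {poly F}) (f g h : {poly {poly F}}).

Lemma dvd_coefs_scale P g : (forall i, P %| g`_i) -> exists g1, g = P *: g1.
Proof.
move=> Pg; exists (\poly_(i < size g) (g`_i %/ P)); apply/polyP => i.
rewrite coefZ coef_poly; case: ltnP => [_|si]; first by rewrite mulrC divpK.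
by rewrite mulr0 nth_default.
Qed.

Lemma irredp_prime_coefs P g h : irreducible_poly P -> P \is monic ->
  (forall i, P %| (g * h)`_i) ->
  (forall i, P %| g`_i) \/ (forall i, P %| h`_i).
Proof.
move=> irrP mP Pgh; pose miP : monic_irreducible_poly P := conj irrP mP.
have mapE (k : {poly {poly F}}) : (forall i, P %| k`_i) <-> map_poly (residue miP) k = 0.
  split=> [Pk|k0 i]; last by rewrite -(residue_eq0 miP) -coef_map k0 coef0.
  by apply/polyP => i; rewrite coef_map coef0; apply/eqP; rewrite residue_eq0.
move/mapE: Pgh; rewrite rmorphM /= => /eqP; rewrite mulf_eq0.
by case/orP => /eqP /mapE; [left|right].
Qed.

(** Induction on the size of c: a prime factor of c divides all coefficients of g or all those of h
    and can be cancelled there. Factorizations over F(T) thus descend to F[T]. *)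
Lemma gauss_factor (c : {poly F}) f g h : c != 0 -> c *: f = g * h ->
  exists g' h' : {poly {poly F}}, exists a b : {poly F},
    [/\ f = g' * h', g = a *: g', h = b *: h', a != 0 & b != 0].
Proof.
have [m] := ubnP (size c); elim: m c g h => // m IH c g h cm c0 cf.
have [c1|c1] := leqP (size c) 1.
  have [x x0 cE] : exists2 x : F, x != 0 & c = x%:P.
    by apply/size_poly1P; rewrite -size_poly_gt0 in c0; apply/eqP; slia.
  exists ((x^-1)%:P *: g), h, c, 1; split; rewrite ?oner_neq0 ?scale1r //.
    by rewrite -scalerAl -cf scalerA cE -polyCM mulVf // scale1r.
  by rewrite scalerA cE -polyCM divff // scale1r.
have [P /andP[mP /irreducibleP irrP] Pc] := exists_prime_dvd c1.
pose c' := c %/ P; have cE : c = P * c' by rewrite mulrC divpK.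
have c'0 : c' != 0 by apply: contraNneq c0 => z; rewrite cE z mulr0.
have P0 := monic_neq0 mP.
have c'm : (size c' < m)%N.
  have := size_mul P0 c'0; rewrite -cE => sc; have := irrP.1.
  by rewrite -size_poly_gt0 in c'0; slia.
have Pinj (u v : {poly {poly F}}) : P *: u = P *: v -> u = v.
  move=> /polyP uv; apply/polyP => i; have := uv i; rewrite !coefZ.
  exact: mulfI.
have : forall i, P %| (g * h)`_i.
  by move=> i; rewrite -cf coefZ cE -mulrA dvdp_mulr.
case/(irredp_prime_coefs irrP mP) => /dvd_coefs_scale[k kE].
  have {cf} /IH : c' *: f = k * h.
    by apply: Pinj; rewrite scalerA -cE cf kE scalerAl.
  case=> // g' [h' [a [b [-> gE hE a0 b0]]]].
  exists g', h', (P * a), b; split=> //; last exact: mulf_neq0.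
  by rewrite kE gE scalerA.
have {cf} /IH : c' *: f = g * k.
  by apply: Pinj; rewrite scalerA -cE cf kE scalerAr.
case=> // g' [h' [a [b [-> gE hE a0 b0]]]].
exists g', h', a, (P * b); split=> //; last exact: mulf_neq0.
by rewrite kE hE scalerA.
Qed.

Lemma size_gt1_nunit f : (1 < size f)%N -> f \isn't a GRing.unit.
Proof. by move=> sf; rewrite poly_unitE; case: eqP => // sf1; slia. Qed.

(** Divisibility by f over F(T) implies divisibility over F[T]: after the descent f = b f' with b
    free of X, and irreducibility makes b a unit because f' has positive degree in X. *)
Lemma irreducible_elt_cancel (c : {poly F}) f g h : irreducible_elt f ->
  (1 < size f)%N -> c != 0 -> c *: g = h * f -> exists h', g = h' * f.
Proof.
move=> [_ _ irrf] sf c0 /(gauss_factor c0)[h' [f' [a [b [gE hE fE a0 b0]]]]].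
have sf' : size f' = size f by rewrite fE size_scale.
have : f = b%:P * f' by rewrite mul_polyC.
case/irrf => [ub|uf']; last first.
  by have := size_gt1_nunit; move/(_ f'); rewrite uf' sf' => /(_ sf).
exists (h' * (b%:P)^-1); rewrite gE fE -mul_polyC -mulrA (mulrA _ b%:P).
by rewrite mulVr // mul1r.
Qed.

(** A zero resultant yields a common factor of positive degree in X over F(T). By Gauss and
    irreducibility it is f up to factors free of X, which are then cancelled. *)
Lemma resultant0_dvd f g : irreducible_elt f -> (1 < size f)%N ->
  resultant f g = 0 -> exists h, g = h * f.
Proof.
move=> irrf sf /eqP; rewrite resultant_eq0; set D := Pdiv.Idomain.gcdp f g => sD.
have /Pdiv.Idomain.dvdpP[[c u] /= c0 cf] := Pdiv.Idomain.dvdp_gcdl f g.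
have /Pdiv.Idomain.dvdpP[[e v] /= e0 eg] := Pdiv.Idomain.dvdp_gcdr f g.
have [u' [D' [a [b [fE _ DE _ b0]]]]] := gauss_factor c0 cf.
have sD' : size D' = size D by rewrite /D DE size_scale.
case: (irrf) => _ _ /(_ _ _ fE) [uu'|uD']; last first.
  by have := size_gt1_nunit; move/(_ D'); rewrite uD' sD' => /(_ sD).
apply: (irreducible_elt_cancel (h := b *: (v * u'^-1)) irrf sf e0).
by rewrite eg DE fE -scalerAl -mulrA mulKr // scalerAr.
Qed.

End GaussLemma.

(** * Resultants and common roots modulo a prime *)

Section ResultantModulo.
Variable F : finFieldType.
Implicit Types (P : {poly F}) (f g : {poly {poly F}}).

(* Completing the s vectors (r_j ^ k)_k to a square matrix V whose determinant is
   a Vandermonde determinant prime to P, the product S V has s columns divisible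
   by P. *)
Lemma det_dvd_vandermonde P (s N : nat) (r : 'I_s -> {poly F})
    (S : 'M[{poly F}]_N) : (s <= N)%N -> irreducible_poly P ->
  (forall i j, i != j -> ~~ (P %| r i - r j)) ->
  (forall i j, P %| \sum_k S i k * r j ^+ k) -> P ^+ s %| \det S.
Proof.
move=> sN irrP dist; have [t NE] : exists t, N = (s + t)%N.
  by exists (N - s)%N; lia.
subst N => Sr.
pose V : 'M[{poly F}]_(s + t) :=
  block_mx (\matrix_(i < s, j < s) r j ^+ i) 0
           (\matrix_(i < t, j < s) r j ^+ (s + i)) 1%:M.
have detV : \det V = \prod_(i < s) \prod_(j < s | (i < j)%N) (r j - r i).
  rewrite det_lblock det1 mulr1.
  have -> : \matrix_(i < s, j < s) r j ^+ i = Vandermonde s (\row_j r j).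
    by apply/matrixP => i j; rewrite !mxE.
  by rewrite det_Vandermonde; do 2!apply: eq_bigr => ? _; rewrite !mxE.
have cop : coprimep (P ^+ s) (\det V).
  have copM x y : coprimep P x -> coprimep P y -> coprimep P (x * y).
    by rewrite coprimepMr => -> ->.
  rewrite detV; apply: coprimep_expl.
  apply: (big_ind (coprimep P)) => [||i _]; [exact: coprimep1|exact: copM|].
  apply: (big_ind (coprimep P)) => [||j ij]; [exact: coprimep1|exact: copM|].
  rewrite irreducible_poly_coprime // dist //; apply: contraTneq ij => ->.
  by rewrite ltnn.
rewrite -(Gauss_dvdpl _ cop) -det_mulmx.
pose W := \matrix_(i < s + t, j < s + t)
  if (j < s)%N then (S *m V) i j %/ P else (S *m V) i j.
pose D := \row_(j < s + t) (if (j < s)%N then P else 1).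
have -> : S *m V = W *m diag_mx D.
  apply/matrixP => i j; rewrite mul_mx_diag [RHS]mxE [W _ _]mxE [D _ _]mxE.
  case: ifP => [js|_]; last by rewrite [RHS]mulr1.
  rewrite divpK // mxE; have -> : j = lshift t (Ordinal js) by apply: val_inj.
  rewrite (eq_bigr (fun k : 'I_(s + t) => S i k * r (Ordinal js) ^+ k)) // => k _.
  by congr (_ * _); case: (fintype.split_ordP k) => k' ->;
     rewrite ?block_mxEul ?block_mxEdl mxE.
rewrite det_mulmx det_diag big_split_ord /= dvdp_mull //.
under eq_bigr do rewrite mxE /= ltn_ord.
by rewrite prodr_const card_ord dvdp_mulr.
Qed.

(** The rows of the Sylvester matrix list the coefficients of X^k f and X^k g, so pairing a row with
    the powers of x evaluates such a polynomial at x. *)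
Lemma Sylvester_row f g (x : {poly F}) (i : 'I_((size g).-1 + (size f).-1)) :
  \sum_k Sylvester_mx f g i k * x ^+ k =
  match fintype.split i with inl k => f.[x] * x ^+ k | inr k => g.[x] * x ^+ k end.
Proof.
pose N := ((size g).-1 + (size f).-1)%N.
have aux (p : {poly {poly F}}) (k : nat) : (k + size p <= N)%N ->
    \sum_(j < N) (p`_(j - k) *+ (k <= j)%N) * x ^+ j = p.[x] * x ^+ k.
  move=> kN; rewrite mulrC -(hornerXn x k) -hornerM.
  rewrite (@horner_coef_wide _ N); last first.
    by apply: leq_trans (size_polyMleq _ _) _; rewrite size_polyXn.
  apply: eq_bigr => j _; rewrite coefXnM ltnNge.
  by case: (k <= j)%N; rewrite /= ?mulr1n ?mulr0n.
under eq_bigr do rewrite Sylvester_mxE.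
case: (fintype.split i) => k; apply: aux; rewrite /N; have := ltn_ord k; slia.
Qed.

Lemma resultant_dvd_roots P f g (s : nat) (r : 'I_s -> {poly F}) :
  (s <= (size g).-1 + (size f).-1)%N -> irreducible_poly P ->
  (forall i j, i != j -> ~~ (P %| r i - r j)) ->
  (forall i, P %| f.[r i]) -> (forall i, P %| g.[r i]) ->
  P ^+ s %| resultant f g.
Proof.
move=> sN irrP dist Pf Pg; apply: (det_dvd_vandermonde sN irrP dist) => i j.
by rewrite Sylvester_row; case: (fintype.split i) => k; rewrite dvdp_mulr.
Qed.

Lemma size_det_leq (N : nat) (S : 'M[{poly F}]_N) (e : 'I_N -> nat) :
  (forall i j, (size (S i j) <= (e i).+1)%N) ->
  (size (\det S) <= (\sum_i e i).+1)%N.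
Proof.
move=> Se; apply: leq_trans (size_sum _ _ _) _; apply/bigmax_leqP => p _.
rewrite mulr_sign (fun_if (fun A : {poly F} => size A)) size_polyN if_same.
apply: leq_trans (size_poly_prod_leq _ _) _; rewrite cardE size_enum_ord leq_subLR.
rewrite addnS ltnS -[X in (X + _)%N]card_ord -sum1_card -big_split /=.
by apply: leq_sum => i _; rewrite add1n.
Qed.

Lemma pdeg_resultant_leq f g (a b : nat) :
  (forall i, size (f`_i)%R <= a.+1)%N -> (forall i, size (g`_i)%R <= b.+1)%N ->
  (pdeg (resultant f g) <= (size g).-1 * a + (size f).-1 * b)%N.
Proof.
move=> fa gb.
pose e (i : 'I_((size g).-1 + (size f).-1)) := if fintype.split i is inl _ then a else b.
have Se i j : (size (Sylvester_mx f g i j) <= (e i).+1)%N.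
  rewrite Sylvester_mxE /e; case: (fintype.split i) => k;
  by case: (k <= j)%N; rewrite /= ?mulr1n ?mulr0n ?size_poly0.
have := size_det_leq Se; rewrite big_split_ord /=.
rewrite (eq_bigr (fun=> a)) => [|i _]; last by rewrite /e (fintype.unsplitK (inl i)).
rewrite [X in (_ + X).+1](eq_bigr (fun=> b)) => [|i _]; last first.
  by rewrite /e (fintype.unsplitK (inr i)).
rewrite !sum_nat_const !card_ord -/(resultant f g) /pdeg.
by case: (size (resultant f g)).
Qed.

End ResultantModulo.

(** * An upper bound of Mertens type *)

Section CongruenceCounting.
Variable F : finFieldType.
Local Notation q := #|F|.

(** Pigeonhole substitute for rank and nullity: subtracting one member of a fibre of [phi] embeds
    the fibre into K. *)
Lemma card_kernel_geq (T : finZmodType) (Y : finType) (phi : T -> Y) (K : pred T) :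
  (forall x y, phi x = phi y -> K (x - y)) -> (#|T| <= #|K| * #|Y|)%N.
Proof.
move=> phiK; rewrite -sum1_card (partition_big phi xpredT) //= mulnC -sum_nat_const.
apply: leq_sum => y _; rewrite sum1_card.
have [z /eqP zy|no] := pickP (fun x => phi x == y); last first.
  by rewrite eq_card0 // => x; rewrite inE; exact: no.
rewrite -(fintype.card_image (@addIr _ (- z))).
apply/subset_leq_card/fintype.subsetP => _ /fintype.imageP[x xy ->].
by apply: phiK; rewrite zy; apply/eqP.
Qed.

(** All differences are multiples of W, so an element of S is determined by a quotient of size at
    most n - deg W. If n < deg W, truncated subtraction gives the bound 1. *)
Lemma card_congr_leq (n : nat) (W : {poly F}) (S : pred {poly_n F}) : W != 0 ->
  (forall x y, S x -> S y -> W %| polyn x - polyn y) -> (#|S| <= q ^ (n - pdeg W))%N.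
Proof.
move=> W0 SW; have [z Sz|no] := pickP S; last by rewrite eq_card0.
pose phi (x : {poly_n F}) : {poly_(n - pdeg W) F} :=
  npolyp _ ((polyn x - polyn z) %/ W).
rewrite -card_npoly -(fintype.card_in_image (f := phi) (A := S)) ?max_card // => x y Sx Sy.
have dvdK u : S u -> polyn u = polyn (phi u) * W + polyn z.
  move=> Su; rewrite npolypK; first by rewrite divpK ?subrK //; exact: SW.
  rewrite size_divp //; have := size_polyD (polyn u) (- polyn z).
  rewrite size_polyN; have := size_npoly u; have := size_npoly z.
  by have := W0; rewrite -size_poly_gt0; slia.
by move=> xy; apply: val_inj; rewrite /= dvdK // xy -dvdK.
Qed.

End CongruenceCounting.

Lemma coef_size_bound (F : finFieldType) (f : {poly {poly F}}) :
  exists a, forall i, (size (f`_i)%R <= a.+1)%N.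
Proof.
exists (\max_(i < size f) size (f`_i)%R)%N => i.
have [si|si] := ltnP i (size f); last by rewrite nth_default ?size_poly0.
by apply: leqW; apply: (leq_bigmax (Ordinal si)).
Qed.

Section MertensUpperBound.
Variables (F : finFieldType) (f : {poly {poly F}}).
Local Notation q := #|F|.
Local Notation d := (size f).-1.
Hypothesis irrf : irreducible_elt f.
Hypothesis d_gt0 : (0 < d)%N.
Implicit Types P : {poly F}.

Let f_gt1 : (1 < size f)%N.
Proof. by move: d_gt0; case: (size f) => [|[]]. Qed.

(** The polynomials alpha of the counting argument: entry (i, j) is the coefficient of X^i T^j.
    Matrices make them a finite additive group of order q^(dH). *)
Definition poly2_of_mx (H : nat) (A : 'M[F]_(d, H)) : {poly {poly F}} :=
  rVpoly (\row_i rVpoly (row i A)).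

Lemma poly2_of_mxB H (A B : 'M[F]_(d, H)) :
  poly2_of_mx (A - B) = poly2_of_mx A - poly2_of_mx B.
Proof.
rewrite /poly2_of_mx -linearB; congr rVpoly.
by apply/rowP => i; rewrite !mxE !linearB.
Qed.

Lemma poly2_of_mx_eq0 H (A : 'M[F]_(d, H)) : (poly2_of_mx A == 0) = (A == 0).
Proof.
apply/eqP/eqP => [A0|->]; last first.
  by rewrite -(subrr 0) poly2_of_mxB subrr.
apply/row_matrixP => i; rewrite row0 -[row i A]rVpolyK.
have -> : rVpoly (row i A) = (poly2_of_mx A)`_i.
  by rewrite coef_rVpoly_ord mxE.
by rewrite A0 coef0 linear0.
Qed.

Lemma size_poly2_of_mx H (A : 'M[F]_(d, H)) : (size (poly2_of_mx A) <= d)%N.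
Proof. exact: size_poly. Qed.

Lemma size_coef_poly2_of_mx H (A : 'M[F]_(d, H)) i :
  (size ((poly2_of_mx A)`_i)%R <= H)%N.
Proof.
rewrite coef_rVpoly; case: insub => [j|]; last by rewrite size_poly0.
by rewrite mxE size_poly.
Qed.

Lemma resultant_neq0 (g : {poly {poly F}}) : g != 0 -> (size g < size f)%N -> resultant f g != 0.
Proof.
move=> g0 gf; apply/eqP => /(resultant0_dvd irrf f_gt1)[h gE].
have h0 : h != 0 by apply: contraNneq g0 => h0; rewrite gE h0 mul0r.
have f0 : f != 0 by rewrite -size_poly_gt0; lia.
have := size_mul h0 f0; rewrite -gE; rewrite -size_poly_gt0 in h0.
by move=> sg; rewrite sg in gf; slia.
Qed.

Definition common_roots (H : nat) P (A : 'M[F]_(d, H)) : pred {poly_(pdeg P) F} :=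
  [pred r : {poly_(pdeg P) F} | (P %| f.[polyn r]) && (P %| (poly2_of_mx A).[polyn r])].
Arguments common_roots {H} P A.

Lemma common_roots_resultant H P (A : 'M[F]_(d, H)) :
  P \is monic -> irreducible_poly P -> ~~ (P %| lead_coef f) ->
  P ^+ #|common_roots P A| %| resultant f (poly2_of_mx A).
Proof.
move=> mP irrP nPl; pose S := common_roots P A.
have Sd : (#|S| <= d)%N.
  apply: leq_trans (nroots_mod_leq mP irrP nPl); apply/subset_leq_card.
  by apply/fintype.subsetP => r; rewrite !inE => /andP[].
apply: (resultant_dvd_roots (r := fun i : 'I_#|S| => polyn (enum_val i))) => //.
- by apply: leq_trans Sd _; rewrite leq_addl.
- move=> i j; apply: contraNN => ij; apply/eqP/enum_val_inj/val_inj.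
  by apply: (small_congr_eq _ _ ij); apply: size_npoly.
- by move=> i; case/andP: (enum_valP i : common_roots P A (enum_val i)).
- by move=> i; case/andP: (enum_valP i : common_roots P A (enum_val i)).
Qed.

Lemma sum_common_roots_leq H n (A : 'M[F]_(d, H)) : A != 0 ->
  (\sum_(P <- prime_polys F n | ~~ (P %| lead_coef f)%R)
     #|common_roots P A| * pdeg P <= pdeg (resultant f (poly2_of_mx A)))%N.
Proof.
move=> A0; have R0 : resultant f (poly2_of_mx A) != 0.
  apply: resultant_neq0; first by rewrite poly2_of_mx_eq0.
  by apply: leq_ltn_trans (size_poly2_of_mx A) _; slia.
apply: leq_trans (@pdeg_prime_powers_le F _ n d _ R0).
rewrite big_seq_cond [leqRHS]big_seq_cond; apply: leq_sum => P.
case/andP=> /prime_polysP[mP irrP _ _] nPl.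
rewrite -big_distrl leq_mul2r /=; apply/orP; right.
have Sd : (#|common_roots P A| <= d)%N.
  apply: leq_trans (nroots_mod_leq mP irrP nPl); apply/subset_leq_card.
  by apply/fintype.subsetP => r; rewrite !inE => /andP[].
have PR := common_roots_resultant A mP irrP nPl.
rewrite -{1}[#|common_roots P A|]card_ord -sum1_card.
rewrite (big_ord_widen d (fun=> 1%N) Sd) big_mkcond /=; apply: leq_sum => k _.
case: ifP => // kS; rewrite (dvdp_trans _ PR) //.
by apply: dvdp_exp2l.
Qed.

(* The condition is linear in A, with values in a space of dimension deg P. *)
Lemma card_vanishing_geq H P (x : {poly F}) : P != 0 -> (pdeg P <= d * H)%N ->
  (q ^ (d * H - pdeg P) <= #|[pred A : 'M[F]_(d, H) | (P %| (poly2_of_mx A).[x])%R]|)%N.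
Proof.
move=> P0 PH; have q0 : (0 < q ^ pdeg P)%N by rewrite expn_gt0 ltnW ?card_field_gt1.
rewrite -(leq_pmul2r q0) -expnD subnK // -card_mx -[X in (_ * X)%N](card_npoly F (pdeg P)).
apply: (card_kernel_geq (phi := fun A => npolyp (pdeg P) ((poly2_of_mx A).[x] %% P))).
move=> A B /(congr1 (@polyn F _)).
have szm (C : {poly F}) : (size (C %% P)%R <= pdeg P)%N.
  by have := ltn_modp C P; rewrite P0; slia.
rewrite !npolypK // => AB; rewrite inE poly2_of_mxB hornerD hornerN.
by rewrite /dvdp modpD modpN AB subrr.
Qed.

(** Triples (A, P, r) with A nonzero and r a common root modulo P, weighted by deg P, are counted
    twice: for fixed A by the degree of the resultant, for fixed P and r by [card_vanishing_geq].
    The term d q^(n+1) pays for the excluded A = 0. *)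
Lemma sum_nroots_box (a H n : nat) : (0 < H)%N -> (n <= d * H)%N ->
  (forall i, size (f`_i)%R <= a.+1)%N ->
  (\sum_(P <- prime_polys F n | ~~ (P %| lead_coef f)%R)
     nroots_mod f P * pdeg P * q ^ (d * H - pdeg P)
   <= q ^ (d * H) * (d * a + d * H) + d * q ^ n.+1)%N.
Proof.
move=> H0 nH fa.
have step1 : (\sum_(A : 'M[F]_(d, H) | A != 0%R)
    \sum_(P <- prime_polys F n | ~~ (P %| lead_coef f)%R)
     #|common_roots P A| * pdeg P <= q ^ (d * H) * (d * a + d * H))%N.
  apply: (@leq_trans (\sum_(A : 'M[F]_(d, H) | A != 0%R) (d * a + d * H))%N).
    apply: leq_sum => A A0; apply: leq_trans (sum_common_roots_leq n A0) _.
    have cA i : (size ((poly2_of_mx A)`_i)%R <= H.-1.+1)%N.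
      by rewrite prednK // size_coef_poly2_of_mx.
    apply: leq_trans (pdeg_resultant_leq fa cA) _; apply: leq_add.
      rewrite leq_mul2r; apply/orP; right.
      by have := size_poly2_of_mx A; slia.
    by rewrite leq_mul2l; apply/orP; right; lia.
  rewrite sum_nat_const leq_mul2r -card_mx max_card orbT //.
rewrite exchange_big /= in step1.
apply: leq_trans (leq_add step1 (_ : d * (\sum_(P <- prime_polys F n) pdeg P) <= _)%N);
  last by rewrite leq_mul2l sum_pdeg_primes orbT.
rewrite big_distrr /=.
apply: (@leq_trans (\sum_(P <- prime_polys F n | ~~ (P %| lead_coef f)%R)
   (\sum_(A : 'M[F]_(d, H) | A != 0%R) #|common_roots P A| * pdeg P + d * pdeg P))%N);
  last first.
  rewrite big_split /= leq_add2l [leqRHS](bigID (fun P => ~~ (P %| lead_coef f)%R)) /=.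
  exact: leq_addr.
rewrite big_seq_cond [leqRHS]big_seq_cond; apply: leq_sum => P.
case/andP=> /prime_polysP[mP irrP P0 dP] nPl.
rewrite -big_distrl /= -mulnDl mulnAC leq_mul2r; apply/orP; right.
apply: leq_trans (leq_add (leqnn _) (nroots_mod_leq mP irrP nPl)).
have -> : (\sum_(A : 'M[F]_(d, H) | A != 0%R) #|common_roots P A| =
  \sum_(r : {poly_(pdeg P) F} | (P %| f.[polyn r])%R)
    #|[pred A : 'M[F]_(d, H) | (A != 0%R) && (P %| (poly2_of_mx A).[polyn r])%R]|)%N.
  rewrite (eq_bigr (fun A => \sum_(r : {poly_(pdeg P) F} | (P %| f.[polyn r])%R)
     (P %| (poly2_of_mx A).[polyn r])%R)%N) => [|A _]; last first.
    rewrite -sum1_card big_mkcondr /=; apply: eq_bigr => r _.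
    by case: (_ %| _).
  rewrite exchange_big /=; apply: eq_bigr => r _.
  rewrite -sum1_card big_mkcondr /=; apply: eq_bigr => A _.
  by case: (_ %| _).
rewrite /nroots_mod -sum1_card big_distrl /= -big_split /=; apply: leq_sum => r _.
rewrite mul1n; apply: (leq_trans (card_vanishing_geq (H := H) (polyn r) P0 _)); first by lia.
rewrite (cardD1 (0 : 'M[F]_(d, H))) addnC; apply: leq_add; last by case: (_ \in _).
by apply/subset_leq_card/fintype.subsetP => A; rewrite !inE.
Qed.

Lemma sum_nroots_leq : exists C : nat, forall n,
  (\sum_(P <- prime_polys F n | ~~ (P %| lead_coef f)%R)
     nroots_mod f P * pdeg P * q ^ (n - pdeg P) <= q ^ n * (n + C))%N.
Proof.
have [a fa] := coef_size_bound f.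
exists (d * a + d + d * q)%N => n.
(* H is chosen with n <= dH <= n + d, so that passing from n to dH costs only a bounded term; this
   and the error terms of [sum_nroots_box] make up the constant. *)
pose H := (n %/ d).+1; have nH : (n <= d * H)%N by rewrite mulnC ltnW // ltn_ceil.
have Hn : (d * H <= n + d)%N by rewrite mulnC /H mulSn addnC leq_add2r leq_trunc_div.
have box := sum_nroots_box (ltn0Sn _) nH fa.
have q0 m : (0 < q ^ m)%N by rewrite expn_gt0 ltnW ?card_field_gt1.
rewrite -(leq_pmul2l (q0 (d * H - n)%N)).
rewrite big_distrr /=; set lhs := (X in (X <= _)%N).
have -> : lhs = (\sum_(P <- prime_polys F n | ~~ (P %| lead_coef f)%R)
     nroots_mod f P * pdeg P * q ^ (d * H - pdeg P))%N.
  rewrite /lhs big_seq_cond [RHS]big_seq_cond; apply: eq_bigr => P /andP[/prime_polysP[_ _ _ dP] _].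
  by case/andP: dP => _ dP; rewrite mulnCA -expnD addnBA // subnK.
apply: leq_trans box _; rewrite mulnA -expnD subnK // expnS.
have qn : (q ^ n <= q ^ (d * H))%N by rewrite leq_exp2l ?card_field_gt1.
have E : (n + (d * a + d + d * q) = (d * a + (n + d)) + d * q)%N.
  by rewrite !addnA (addnC n).
rewrite E [leqRHS]mulnDr.
apply: leq_add; first by rewrite leq_mul2l leq_add2l Hn orbT.
by rewrite mulnA mulnC leq_mul2r qn orbT.
Qed.

End MertensUpperBound.

(** * Derivatives and square divisors *)

Section PowerOfCharacteristic.
Variables (R : idomainType) (p : nat).
Hypothesis pcharR : p \in [pchar R].

(** A zero derivative leaves only exponents divisible by p; as the coefficients are p-th powers,
    additivity of Frobenius gives a p-th root. *)
Lemma poly_deriv0_pow (h : {poly R}) (c : nat -> R) :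
  h^`() = 0 -> (forall i, h`_i = c i ^+ p) -> exists k, h = k ^+ p.
Proof.
move=> h'0 hc; have pr_p := pcharf_prime pcharR.
have pcharP : p \in [pchar {poly R}] by rewrite pchar_poly.
exists (\sum_(i < size h) c (i * p)%N *: 'X^i).
rewrite -(pFrobenius_autE pcharP) rmorph_sum /=.
rewrite (eq_bigr (fun i : 'I_(size h) => h`_(i * p) *: 'X^(i * p))) => [|i _]; last first.
  by rewrite pFrobenius_autE exprZn -hc exprM.
apply/polyP => j; rewrite coef_sumMXn.
have [/dvdnP[i ->]|npj] := boolP (p %| j)%N; last first.
  rewrite big1 => [|i /eqP ij]; last by rewrite -ij dvdn_mull in npj.
  case: j npj => [|j]; first by rewrite dvdn0.
  move=> npj; have /eqP := congr1 (fun u : {poly R} => u`_j) h'0.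
  rewrite coef_deriv coef0 -mulr_natr mulf_eq0 -(dvdn_pcharf pcharR) (negPf npj).
  by rewrite orbF => /eqP.
have p0 := prime_gt0 pr_p.
have [si|si] := ltnP i (size h).
  rewrite (big_pred1 (Ordinal si)) // => k /=.
  by rewrite eqn_pmul2r.
rewrite nth_default; last by rewrite (leq_trans si) // leq_pmulr.
rewrite big1 // => k /eqP ki; rewrite ki nth_default //.
by rewrite (leq_trans si) // leq_pmulr.
Qed.

End PowerOfCharacteristic.

Section Derivations.
Variable F : finFieldType.
Implicit Types (P Q D : {poly F}) (f : {poly {poly F}}).

Definition derivT f : {poly {poly F}} := map_poly (@deriv F) f.

Lemma coef_derivT f i : (derivT f)`_i = (f`_i)^`().
Proof. by rewrite /derivT coef_map. Qed.

(** Chain rule for f(T, Q(T)), by induction on f in Horner form. *)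
Lemma deriv_value f Q :
  (f.[Q])^`() = (derivT f + Q^`() *: f^`()).[Q].
Proof.
have derivTM g (c : {poly F}) : derivT (g * 'X + c%:P) = derivT g * 'X + (c^`())%:P.
  apply/polyP => i; rewrite !(coefD, coef_derivT, coefMX, coefC) derivD.
  by case: i => [|i] /=; rewrite ?deriv0.
elim/poly_ind: f => [|g c IH].
  have -> : derivT 0 = 0 by apply/polyP => i; rewrite coef_derivT !coef0 deriv0.
  by rewrite !deriv0 scaler0 addr0 !horner0 deriv0.
rewrite derivTM derivMXaddC !hornerE derivD derivM IH !hornerE.
ring.
Qed.

(** If both partial derivatives vanish, f is a polynomial in T^p and X^p; as F is perfect, f is a
    p-th power. *)
Lemma derivT_deriv0_reducible f :
  derivT f = 0 -> f^`() = 0 -> ~ irreducible_elt f.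
Proof.
move=> fT fX [f0 nuf irrf]; have [p pr_p pcharF] := finPcharP F.
have pth (x : F) : exists y, x = y ^+ p.
  have inj : injective (pFrobenius_aut pcharF) by exact: fmorph_inj.
  have /codomP[y xE] := injF_onto inj x; exists y.
  by rewrite xE pFrobenius_autE.
have /choice[c fc] i : exists c, f`_i = c ^+ p.
  have /choice[e fe] j : exists e, f`_i`_j = e ^+ p by exact: pth.
  apply: (poly_deriv0_pow pcharF (c := e)) => //.
  by rewrite -coef_derivT fT coef0.
have pcharP : p \in [pchar {poly F}] by rewrite pchar_poly.
have [k fk] := poly_deriv0_pow pcharP fX fc.
have uk : k \isn't a GRing.unit.
  by apply: contra nuf => uk; rewrite fk unitrX.
have p1 := prime_gt1 pr_p.
have : f = k * k ^+ p.-1 by rewrite -exprS prednK // ltnW.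
case/irrf => [|]; first by rewrite (negPf uk).
by rewrite unitrX_pos ?(negPf uk) //; lia.
Qed.

Lemma dvd_sqr_deriv P (A : {poly F}) : P ^+ 2 %| A -> P %| A^`().
Proof.
move=> /dvdpP[B ->]; rewrite derivM expr2 derivM.
apply: dvdp_add; apply: dvdp_mull; first exact: dvdp_mull.
by apply: dvdp_add; [exact: dvdp_mull | exact: dvdp_mulr].
Qed.

Section Irreducible.
Variable f : {poly {poly F}}.
Hypothesis irrf : irreducible_elt f.
Local Notation d := (size f).-1.
Hypothesis d_gt0 : (0 < d)%N.

Let f_gt1 : (1 < size f)%N.
Proof. by move: d_gt0; case: (size f) => [|[]]. Qed.

Let f0 : f != 0.
Proof. by rewrite -size_poly_gt0; apply: ltnW. Qed.

Lemma size_derivT : (size (derivT f) <= size f)%N.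
Proof. exact: size_poly. Qed.

(** Suppose f_T = h f. If h = 0, both partial derivatives vanish and f is reducible. Otherwise h is
    free of X, and the leading coefficient of f divides its own derivative with nonzero quotient,
    against degrees in T. *)
Lemma resultant_derivT_neq0 : f^`() = 0 -> resultant f (derivT f) != 0.
Proof.
move=> fX; apply/eqP => /(resultant0_dvd irrf f_gt1)[h fTE].
have [h0|h0] := eqVneq h 0.
  by apply: (derivT_deriv0_reducible _ fX irrf); rewrite fTE h0 mul0r.
have [c hE] : exists c, h = c%:P.
  have := size_derivT; rewrite fTE size_mul // => sh.
  by exists h`_0; apply: size1_polyC; slia.
have := congr1 (fun u : {poly {poly F}} => u`_d) fTE.
have lf0 : lead_coef f != 0 by rewrite lead_coef_eq0.
have c0 : c != 0 by apply: contraNneq h0 => c0; rewrite hE c0 polyC0.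
rewrite coef_derivT hE coefCM -/(lead_coef f) => E.
have := lt_size_deriv lf0; rewrite E size_mul //.
by rewrite -size_poly_gt0 in c0; slia.
Qed.

Lemma resultant_deriv_neq0 : f^`() != 0 -> resultant f f^`() != 0.
Proof. by move=> fX; apply: resultant_neq0 => //; apply: lt_size_deriv. Qed.

(** Two vanishing resultants make f divide (D1 - D2) f_X, whose degree in X is less than that of f.
    If f_X = 0, the resultant is that of f and f_T, which is nonzero. *)
Lemma resultant_total_deriv0_uniq D1 D2 :
  resultant f (derivT f + D1 *: f^`()) = 0 ->
  resultant f (derivT f + D2 *: f^`()) = 0 -> D1 = D2.
Proof.
have [fX|fX] := eqVneq f^`() 0.
  by rewrite fX !scaler0 addr0 => /eqP; rewrite (negPf (resultant_derivT_neq0 fX)).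
move=> /(resultant0_dvd irrf f_gt1)[h1 E1] /(resultant0_dvd irrf f_gt1)[h2 E2].
apply/eqP; rewrite -subr_eq0; apply/negPn/negP => D0.
have E : (D1 - D2) *: f^`() = (h1 - h2) * f.
  by rewrite mulrBl -E1 -E2 scalerBl opprD addrACA subrr add0r.
have h0 : h1 - h2 != 0.
  apply: contraNneq fX => h0; move/eqP: E; rewrite h0 mul0r -mul_polyC mulf_eq0.
  by rewrite polyC_eq0 (negPf D0).
have := congr1 (fun u : {poly {poly F}} => size u) E.
rewrite size_scale // size_mul //; have := lt_size_deriv f0.
by rewrite -size_poly_gt0 in h0; slia.
Qed.

Lemma resultant_root_dvd P Q g : irreducible_poly P ->
  P %| f.[Q] -> P %| g.[Q] -> P %| resultant f g.
Proof.
move=> irrP Pf Pg; rewrite -[P]expr1.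
apply: (resultant_dvd_roots (r := fun _ : 'I_1 => Q)) => //.
  by apply: leq_trans d_gt0 _; rewrite leq_addl.
by move=> i j; rewrite !ord1.
Qed.

Lemma sqr_dvd_resultant P Q : irreducible_poly P -> P ^+ 2 %| f.[Q] ->
  P %| resultant f (derivT f + Q^`() *: f^`()).
Proof.
move=> irrP P2; apply: (resultant_root_dvd irrP (Q := Q)).
  by apply: dvdp_trans P2; rewrite dvdp_mull.
by rewrite -deriv_value; apply: dvd_sqr_deriv.
Qed.

End Irreducible.
End Derivations.

(** * Monic polynomials of given degree and the degrees of their values *)

Section MonicParametrization.
Variables (F : finFieldType) (n : nat).
Implicit Types (Q : {poly F}) (y : {poly_n F}).

(** M_n is indexed by the lower coefficients, since [{poly_n F}] is a finite additive group of order
    q^n in which p-th powers can be added. *)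
Definition monic_of y : {poly F} := 'X^n + polyn y.

Lemma size_monic_of y : size (monic_of y) = n.+1.
Proof. by rewrite size_polyDl size_polyXn // ltnS size_npoly. Qed.

Lemma monic_of_monic y : monic_of y \is monic.
Proof.
rewrite monicE /lead_coef size_monic_of coefD coefXn eqxx.
by rewrite nth_default ?addr0 // size_npoly.
Qed.

Lemma pdeg_monic_of y : pdeg (monic_of y) = n.
Proof. by rewrite /pdeg size_monic_of. Qed.

Lemma monic_of_surj Q : Q \is monic -> pdeg Q = n -> exists y, Q = monic_of y.
Proof.
move=> mQ dQ; have Q0 := monic_neq0 mQ.
have sQ : size Q = n.+1 by rewrite -size_poly_gt0 in Q0; slia.
exists (npolyp n (Q - 'X^n)); rewrite /monic_of npolypK; first by rewrite addrC subrK.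
apply/leq_sizeP => j; rewrite leq_eqVlt => /orP[/eqP<-|nj].
  move: mQ; rewrite monicE /lead_coef sQ /= => /eqP Qn.
  by rewrite coefB coefXn eqxx Qn subrr.
by rewrite coefB coefXn gtn_eqF // nth_default ?sQ // subrr.
Qed.

End MonicParametrization.

Section ValueDegrees.
Variables (F : finFieldType) (f : {poly {poly F}}) (a : nat).
Local Notation d := (size f).-1.
Hypothesis fa : forall i, (size (f`_i)%R <= a.+1)%N.
Implicit Types Q : {poly F}.

Lemma size_term_leq Q n i : (size Q <= n.+1)%N ->
  (size (f`_i * Q ^+ i)%R <= (a + i * n).+1)%N.
Proof.
move=> sQ; apply: leq_trans (size_polyMleq _ _) _.
have := size_poly_exp_leq Q i; have : ((size Q).-1 * i <= i * n)%N.
  by rewrite mulnC leq_mul2l; apply/orP; right; slia.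
by have := fa i; slia.
Qed.

Lemma pdeg_value_leq Q n : (size Q <= n.+1)%N -> (pdeg f.[Q] <= a + d * n)%N.
Proof.
move=> sQ; suff : (size f.[Q] <= (a + d * n).+1)%N by rewrite /pdeg; case: (size _).
rewrite horner_coef; apply: leq_trans (size_sum _ _ _) _; apply/bigmax_leqP => i _.
apply: leq_trans (size_term_leq i sQ) _; rewrite ltnS leq_add2l leq_mul2r.
by apply/orP; right; have := ltn_ord i; slia.
Qed.

Hypothesis f_neq0 : f != 0.

(** For n > a the leading term f_d Q^d dominates: a lower term has degree at most a + (d - 1) n < d
    n. *)
Lemma pdeg_value_geq Q n : (a < n)%N -> size Q = n.+1 ->
  f.[Q] != 0 /\ (d * n <= pdeg f.[Q])%N.
Proof.
move=> an sQ; suff : (d * n < size f.[Q])%N.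
  move=> H; rewrite -size_poly_gt0; split; first exact: leq_ltn_trans H.
  by move: H; rewrite /pdeg; case: (size f.[Q]).
have Q0 : Q != 0 by rewrite -size_poly_gt0 sQ.
have l0 : lead_coef f != 0 by rewrite lead_coef_eq0.
have slead : (d * n < size (f`_d * Q ^+ d)%R)%N.
  rewrite size_mul ?expf_neq0 // -/(lead_coef f).
  have := size_exp Q d; have : size (Q ^+ d) != 0%N by rewrite size_poly_eq0 expf_neq0.
  by rewrite -size_poly_gt0 in l0; rewrite sQ /= mulnC; slia.
rewrite horner_coef (polySpred f_neq0) big_ord_recr /= addrC size_polyDl //.
have [d0|d0] := posnP d.
  rewrite big1 ?size_poly0; first exact: leq_ltn_trans slead.
  by move=> i; have := ltn_ord i; rewrite {2}d0.
apply: leq_ltn_trans slead; apply: leq_trans (size_sum _ _ _) _.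
apply/bigmax_leqP => i _; apply: leq_trans (size_term_leq (n := n) i _) _; first by rewrite sQ.
have id : (i.+1 * n <= d * n)%N by rewrite leq_mul2r ltn_ord orbT.
by apply: leq_trans id; rewrite mulSn; lia.
Qed.

End ValueDegrees.

(** * Primes whose square divides a value *)

Section SquareDivisors.
Variables (F : finFieldType) (f : {poly {poly F}}).
Local Notation q := #|F|.
Local Notation d := (size f).-1.
Hypothesis irrf : irreducible_elt f.
Hypothesis d_gt0 : (0 < d)%N.

Lemma card_fibers_leq (X Y : finType) (phi : X -> Y) (N : nat) :
  (forall x, N <= #|[pred z | phi z == phi x]|)%N -> (#|codom phi| * N <= #|X|)%N.
Proof.
move=> fib; rewrite -[#|X|]sum1_card (partition_big phi (mem (codom phi))) /=; last first.
  by move=> x _; exact: codom_f.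
rewrite -sum_nat_const; apply: leq_sum => y /codomP[x ->].
by rewrite sum1_card; apply: leq_trans (fib x) _; apply: subset_leq_card; apply/fintype.subsetP.
Qed.

Section Translations.
Variables (p n : nat).
Hypothesis pcharF : p \in [pchar F].
Local Notation b := (n %/ p)%N.
Let p_gt1 : (1 < p)%N. Proof. exact/prime_gt1/pcharf_prime/pcharF. Qed.
Let pcharP : p \in [pchar {poly F}]. Proof. by rewrite pchar_poly. Qed.

Lemma deriv_powp (A : {poly F}) : (A ^+ p)^`() = 0.
Proof. by rewrite deriv_exp -mulr_natr (pcharf0 pcharP) mulr0. Qed.

Lemma powp_inj : injective (fun A : {poly F} => A ^+ p).
Proof.
move=> A B /= /eqP; rewrite -subr_eq0 -!(pFrobenius_autE pcharP) -rmorphB.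
by rewrite /= pFrobenius_autE expf_eq0 => /andP[_]; rewrite subr_eq0 => /eqP.
Qed.

Lemma size_powp (B : {poly_b F}) : (size ('X * polyn B ^+ p)%R <= n)%N.
Proof.
have [->|B0] := eqVneq (polyn B) 0.
  by rewrite expr0n (gtn_eqF (ltnW p_gt1)) mulr0n mulr0 size_poly0.
have Bp0 : polyn B ^+ p != 0 by rewrite expf_neq0.
rewrite mulrC size_mulX //; have := size_exp (polyn B) p.
have : size (polyn B ^+ p) != 0%N by rewrite size_poly_eq0.
have sB : (0 < size (polyn B) <= b)%N by rewrite size_poly_gt0 B0 size_npoly.
have : (size (polyn B) * p <= n)%N.
  by apply: leq_trans (leq_trunc_div n p); rewrite leq_mul2r; case/andP: sB => _ ->; rewrite orbT.
move: p_gt1; move: sB.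
move: (size (polyn B ^+ p)) => s; move: (size _) => t; nia.
Qed.

Definition deriv_of (y : {poly_n F}) : {poly_n F} := npolyp n (monic_of y)^`().

Lemma deriv_ofE y : polyn (deriv_of y) = (monic_of y)^`().
Proof.
apply: npolypK; rewrite -ltnS -(size_monic_of y) lt_size_deriv //.
exact/monic_neq0/monic_of_monic.
Qed.

(* Adding a p-th power B ^ p to y does not change the derivative. *)
Lemma card_derivs_leq : (#|codom deriv_of| * q ^ b <= q ^ n)%N.
Proof.
rewrite -[X in (_ <= X)%N](card_npoly F n); apply: card_fibers_leq => y.
have sB (B : {poly_b F}) : (size (polyn B ^+ p)%R <= n)%N.
  apply: leq_trans (size_powp B); have [->|Bp0] := eqVneq (polyn B ^+ p) 0.
    by rewrite size_poly0.
  by rewrite mulrC size_mulX.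
pose phi (B : {poly_b F}) : {poly_n F} := y + npolyp n (polyn B ^+ p).
have phi_inj : injective phi.
  move=> B C /addrI /(congr1 (@polyn F _)); rewrite !npolypK //.
  by move=> /powp_inj ?; apply: val_inj.
rewrite -card_npoly -(fintype.card_image phi_inj).
apply/subset_leq_card/fintype.subsetP => _ /fintype.imageP[B _ ->].
rewrite inE; apply/eqP/val_inj; rewrite /= !deriv_ofE /monic_of /phi /= npolypK //.
by rewrite addrA derivD deriv_powp addr0.
Qed.

(* Adding T B ^ p to y changes the derivative by B ^ p. *)
Lemma card_const_deriv_leq (S : pred {poly_n F}) :
  (forall y z, S y -> S z -> (monic_of y)^`() = (monic_of z)^`()) ->
  (#|S| * q ^ b <= q ^ n)%N.
Proof.
move=> Sc; rewrite -(card_npoly F b) -(card_npoly F n) -cardX.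
pose phi (x : {poly_n F} * {poly_b F}) : {poly_n F} :=
  x.1 + npolyp n ('X * polyn x.2 ^+ p).
rewrite -(fintype.card_in_image (f := phi)) ?max_card //.
move=> [y B] [z C] /andP[/= Sy _] /andP[/= Sz _] /(congr1 (@polyn F _)) /=.
rewrite !npolypK ?size_powp // => E.
(* Differentiating removes y and z, whose derivatives agree by hypothesis, and leaves B^p = C^p. *)
have := congr1 (fun A => ('X^n + A)^`()) E.
rewrite /= !addrA !derivD -!derivD -/(monic_of y) -/(monic_of z).
rewrite derivD [RHS]derivD (Sc y z) // !derivM !deriv_powp !derivX !mul1r !mulr0 !addr0.
move=> /addrI /powp_inj BC; move: E; rewrite BC => /addIr yz.
by congr (_, _); apply: val_inj.
Qed.

End Translations.

Lemma large_primes_count_leq (A : {poly F}) (c n m : nat) : A != 0 ->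
  (pdeg A <= c * n.+1)%N ->
  (\sum_(P <- prime_polys F m | (n < pdeg P)%N) (P %| A)%R <= c)%N.
Proof.
move=> A0 dA; rewrite -(leq_pmul2r (ltn0Sn n)).
apply: leq_trans dA; apply: leq_trans (sum_prime_dvd_le m (fun P => n < pdeg P)%N A0).
rewrite big_distrl /= [leqRHS]big_mkcondr /=; apply: leq_sum => P nP.
by case: (P %| A); rewrite ?mul1n.
Qed.

(** A large P with P^2 | f(Q) divides the resultant attached to Q' if that is nonzero, and in any
    case divides f(Q). As these have degree O(n), the first case costs boundedly many primes per
    derivative, the second boundedly many per Q with zero resultant. *)
Lemma square_divisors_count (a n m : nat) :
  (forall i, size (f`_i)%R <= a.+1)%N -> (a < n)%N ->
  (count (fun P => (n < pdeg P)%N &&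
     [exists y : {poly_n F}, (P ^+ 2 %| f.[monic_of y])%R]) (prime_polys F m) <=
   (2 * d * a + d) * #|codom (@deriv_of n)| +
   (a + d) * #|[pred y : {poly_n F} |
       (resultant f (derivT f + (monic_of y)^`() *: f^`()) == 0)%R]|)%N.
Proof.
move=> fa an; have f0 : f != 0 by case: irrf.
pose Rs (D : {poly F}) := resultant f (derivT f + D *: f^`()).
have dRs (D : {poly_n F}) : (pdeg (Rs (polyn D)) <= (2 * d * a + d) * n.+1)%N.
  have gn i : (size ((derivT f + polyn D *: f^`())`_i)%R <= (a + n).+1)%N.
    rewrite coefD coef_derivT coefZ coef_deriv.
    apply: leq_trans (size_polyD _ _) _; rewrite geq_max; apply/andP; split.
      by apply: leq_trans (size_poly _ _) _; have := fa i; slia.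
    apply: leq_trans (size_polyMleq _ _) _; have := size_npoly D.
    have : (size (f`_i.+1 *+ i.+1)%R <= a.+1)%N.
      by rewrite -scaler_nat; apply: leq_trans (size_scale_leq _ _) _.
    by slia.
  have sg : (size (derivT f + polyn D *: f^`())%R <= size f)%N.
    apply: leq_trans (size_polyD _ _) _; rewrite geq_max size_derivT /=.
    by apply: leq_trans (size_scale_leq _ _) _; apply/ltnW/lt_size_deriv.
  apply: leq_trans (pdeg_resultant_leq fa gn) _.
  apply: (@leq_trans (d * a + d * (a + n)))%N.
    by rewrite leq_add2r leq_mul2r; apply/orP; right; slia.
  by move: d => k; nia.
have dval (y : {poly_n F}) : f.[monic_of y] != 0 /\ (pdeg f.[monic_of y] <= (a + d) * n.+1)%N.
  have [fy0 _] := pdeg_value_geq fa f0 an (size_monic_of y); split=> //.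
  have sQ : (size (monic_of y) <= n.+1)%N by rewrite size_monic_of.
  apply: leq_trans (pdeg_value_leq fa sQ) _.
  by move: d => k; nia.
rewrite -sum1_count.
apply: (@leq_trans (\sum_(P <- prime_polys F m | (n < pdeg P)%N)
   (\sum_(D in codom (@deriv_of n) | Rs (polyn D) != 0%R) (P %| Rs (polyn D))%R +
    \sum_(y : {poly_n F} | Rs (monic_of y)^`() == 0%R) (P %| f.[monic_of y])%R))%N).
  rewrite big_mkcondr /= big_seq_cond [leqRHS]big_seq_cond; apply: leq_sum => P.
  move=> /andP[/prime_polysP[_ irrP _ _] _]; case: existsP => // -[y P2].
  have [R0|R0] := boolP (Rs (monic_of y)^`() == 0).
    have Pf : P %| f.[monic_of y] by apply: dvdp_trans P2; rewrite dvdp_mull.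
    by rewrite [X in (_ + X)%N](bigD1 y) //= Pf addnCA leq_addr.
  rewrite (bigD1 (deriv_of y)) /=; last by rewrite codom_f deriv_ofE.
  by rewrite deriv_ofE (sqr_dvd_resultant d_gt0 irrP P2) -addnA leq_addr.
rewrite big_split /= exchange_big [X in (_ + X)%N]exchange_big /=; apply: leq_add.
  apply: (@leq_trans (\sum_(D in codom (@deriv_of n) | Rs (polyn D) != 0%R) (2 * d * a + d)))%N.
    by apply: leq_sum => D /andP[_ R0]; apply: large_primes_count_leq.
  rewrite sum_nat_const mulnC leq_mul2l; apply/orP; right.
  by apply/subset_leq_card/fintype.subsetP => D; rewrite unfold_in => /andP[].
rewrite mulnC -sum_nat_const; apply: leq_sum => y _.
by have [fy0 dy] := dval y; apply: large_primes_count_leq.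
Qed.

(** The derivatives, and the Q with zero resultant, which share one derivative, each number at most
    q^(n - b), where b is n / p rounded down. Once b >= e c, the saving q^b exceeds e c. *)
Lemma square_divisors_negligible (e : nat) : exists N, forall n m, (N <= n)%N ->
  (e * count (fun P => (n < pdeg P)%N &&
     [exists y : {poly_n F}, (P ^+ 2 %| f.[monic_of y])%R]) (prime_polys F m) <= q ^ n)%N.
Proof.
have [p pr_p pcharF] := finPcharP F; have p0 := prime_gt0 pr_p.
have [a fa] := coef_size_bound f.
pose c := (2 * d * a + d + (a + d))%N.
exists (maxn a.+1 (e * c * p)) => n m; rewrite geq_max => /andP[an ecn].
have q0 : (0 < q ^ (n %/ p))%N by rewrite expn_gt0 ltnW ?card_field_gt1.
rewrite -(leq_pmul2r q0) -mulnA.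
have key : (count (fun P => (n < pdeg P)%N &&
    [exists y : {poly_n F}, (P ^+ 2 %| f.[monic_of y])%R]) (prime_polys F m) *
    q ^ (n %/ p) <= c * q ^ n)%N.
  apply: leq_trans (leq_mul (square_divisors_count m fa an) (leqnn _)) _.
  rewrite /c mulnDl [leqRHS]mulnDl -!mulnA; apply: leq_add; rewrite leq_mul2l; apply/orP; right.
    exact: card_derivs_leq.
  apply: card_const_deriv_leq => // y z /eqP Ry /eqP Rz.
  exact: (resultant_total_deriv0_uniq irrf d_gt0 Ry Rz).
apply: leq_trans (leq_mul (leqnn e) key) _; rewrite mulnA mulnC leq_mul2l; apply/orP; right.
apply: leq_trans (ltnW (ltn_expl _ (card_field_gt1 F))).
by rewrite leq_divRL.
Qed.

End SquareDivisors.

(** * The degree of the lcm *)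

Section GoodPrimes.
Variables (F : finFieldType) (f : {poly {poly F}}).
Local Notation q := #|F|.
Local Notation d := (size f).-1.
Implicit Types P Q : {poly F}.

Lemma dvd_horner_sub (h : {poly {poly F}}) Q1 Q2 : Q1 - Q2 %| h.[Q1] - h.[Q2].
Proof.
have : root (h - h.[Q2]%:P) Q2 by rewrite rootE !hornerE subrr.
case/factor_theorem => g /(congr1 (fun u : {poly {poly F}} => u.[Q1])).
by rewrite !hornerE => ->; rewrite dvdp_mull.
Qed.

(** The uniqueness half of Hensel's lemma: f has at most rho(P) roots modulo each P^k with k >= 1.
    The form also suits f_X = 0, where for almost all P no roots modulo P^2 exist. *)
Definition hensel_prime P := ~~ (P %| lead_coef f) /\
  forall k Q1 Q2, P ^+ k %| f.[Q1] -> P ^+ k %| f.[Q2] -> P %| Q1 - Q2 ->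
    P ^+ k %| Q1 - Q2.

(** The y are sorted by the residue of the argument modulo P. Within one class the arguments are
    congruent modulo P^(k+1) by [hensel_prime], hence so are the y, as M is invertible modulo P. *)
Lemma card_hensel_leq P (Q0 M : {poly F}) (m k : nat) :
  irreducible_poly P -> hensel_prime P -> ~~ (P %| M) ->
  (#|[pred y : {poly_m F} | (P ^+ k.+1 %| f.[Q0 + M * monic_of y])%R]| <=
     nroots_mod f P * q ^ (m - k.+1 * pdeg P))%N.
Proof.
move=> irrP [_ hens] nPM.
have P0 : P != 0 by apply/eqP => P0; have := irrP.1; rewrite P0 size_poly0.
pose Qy (y : {poly_m F}) := Q0 + M * monic_of y.
pose phi (y : {poly_m F}) : {poly_(pdeg P) F} := npolyp _ (Qy y %% P).
have phiE y : polyn (phi y) = Qy y %% P.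
  by apply: npolypK; have := ltn_modp (Qy y) P; rewrite P0; slia.
have phi_congr y : P %| Qy y - polyn (phi y).
  by rewrite phiE {1}(divp_eq (Qy y) P) addrK dvdp_mull.
rewrite -sum1_card (partition_big phi (fun r => P %| f.[polyn r])) /=; last first.
  move=> y Py; rewrite -(dvdp_subr _ (_ : P %| f.[Qy y])).
    by apply: dvdp_trans (phi_congr y) (dvd_horner_sub _ _ _).
  by apply: dvdp_trans Py; rewrite exprS dvdp_mulr.
rewrite /nroots_mod -sum_nat_const; apply: leq_sum => r _; rewrite sum1_card.
rewrite -pdegX; apply: card_congr_leq; first by rewrite expf_neq0.
move=> y z /andP[Py /eqP ry] /andP[Pz /eqP rz].
have Qyz : Qy y - Qy z = M * (polyn y - polyn z).
  by rewrite /Qy /monic_of; ring.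
have : P ^+ k.+1 %| Qy y - Qy z.
  apply: hens => //; have -> : Qy y - Qy z = (Qy y - polyn (phi y)) - (Qy z - polyn (phi z)).
    by rewrite ry rz; ring.
  by rewrite dvdp_sub.
by rewrite Qyz Gauss_dvdpr // coprimep_expl // irreducible_poly_coprime.
Qed.

Hypothesis irrf : irreducible_elt f.
Hypothesis d_gt0 : (0 < d)%N.

(** If f_X = 0, a root modulo P^2 forces P to divide the resultant of f and f_T. Otherwise, for P
    prime to the resultant of f and f_X, the roots are simple: f(Q1) - f(Q2) = g(Q1) (Q1 - Q2),
    where g(Q1) is congruent to f_X(Q2), a unit modulo P. *)
Lemma almost_all_hensel : exists2 D : {poly F}, D != 0 &
  forall P, irreducible_poly P -> ~~ (P %| D) -> hensel_prime P.
Proof.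
have l0 : lead_coef f != 0 by rewrite lead_coef_eq0; case: irrf.
have [fX|fX] := eqVneq f^`() 0.
  exists (lead_coef f * resultant f (derivT f)).
    by rewrite mulf_neq0 // resultant_derivT_neq0.
  move=> P irrP; rewrite irredp_prime // negb_or => /andP[nPl nPR]; split=> //.
  move=> [|[|k]] Q1 Q2; rewrite ?expr0 ?dvd1p ?expr1 // => P1 _ _.
  case/negP: nPR; have := sqr_dvd_resultant d_gt0 irrP (Q := Q1).
  rewrite fX scaler0 addr0; apply; apply: dvdp_trans P1.
  exact: dvdp_exp2l.
exists (lead_coef f * resultant f f^`()).
  by rewrite mulf_neq0 // resultant_deriv_neq0.
move=> P irrP; rewrite irredp_prime // negb_or => /andP[nPl nPR]; split=> //.
move=> [|k] Q1 Q2; first by rewrite expr0 !dvd1p.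
move=> P1 P2 P12.
have : root (f - f.[Q2]%:P) Q2 by rewrite rootE !hornerE subrr.
case/factor_theorem => g gE.
have E1 : f.[Q1] - f.[Q2] = g.[Q1] * (Q1 - Q2).
  by have := congr1 (fun u : {poly {poly F}} => u.[Q1]) gE; rewrite !hornerE.
have E2 : f^`().[Q2] = g.[Q2].
  have := congr1 (fun u : {poly {poly F}} => u^`().[Q2]) gE.
  rewrite derivB derivC subr0 => ->.
  by rewrite derivM derivXsubC !hornerE subrr mulr0 add0r.
have : P ^+ k.+1 %| g.[Q1] * (Q1 - Q2) by rewrite -E1 dvdp_sub.
rewrite Gauss_dvdpr // coprimep_expl // irreducible_poly_coprime //.
apply: contra nPR => Pg; apply: (resultant_root_dvd d_gt0 irrP (Q := Q2)).
  by apply: dvdp_trans P2; rewrite exprS dvdp_mulr.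
have -> : f^`().[Q2] = g.[Q1] - (g.[Q1] - g.[Q2]) by rewrite E2 opprB addrC subrK.
by rewrite dvdp_sub //; apply: dvdp_trans P12 (dvd_horner_sub _ _ _).
Qed.

End GoodPrimes.

(** * Geometric sums over primes *)

Section GeometricSums.
Variable F : finFieldType.
Local Notation q := #|F|.
Let q_gt1 : (1 < q)%N := card_field_gt1 F.

Lemma expn_double m p : (0 < p <= m)%N -> (2 * q ^ (m - p) <= q ^ m)%N.
Proof.
case/andP=> p0 pm; rewrite -{2}(subnK pm) expnD mulnC leq_mul2l; apply/orP; right.
by apply: leq_trans (ltn_expl p q_gt1).
Qed.

(** A geometric series of ratio at most 1/2 is at most twice its first term. The indicator removes
    the terms with (k+1) p > m, where truncated subtraction would leave q^0 = 1. *)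
Lemma geom_step_leq K m p : (0 < p)%N ->
  (\sum_(k < K) (k.+1 * p <= m)%N * q ^ (m - k.+1 * p) <= (p <= m)%N * (2 * q ^ (m - p)))%N.
Proof.
move=> p0.
have rec J n : (\sum_(k < J.+1) (k.+1 * p <= n)%N * q ^ (n - k.+1 * p) =
    (p <= n)%N * (q ^ (n - p) + \sum_(k < J) (k.+1 * p <= n - p)%N * q ^ (n - p - k.+1 * p)))%N.
  rewrite big_ord_recl mul1n mulnDr; congr (_ + _)%N; rewrite big_distrr /=.
  apply: eq_bigr => k _; rewrite /bump /= add1n mulnA; congr (_ * q ^ _)%N; last by nia.
  by have [pn|pn] := leqP p n; nia.
have weak J : forall n, (\sum_(k < J) (k.+1 * p <= n)%N * q ^ (n - k.+1 * p) <= q ^ n)%N.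
  elim: J => [|J IH] n; first by rewrite big_ord0.
  rewrite rec; have [pn|//] := leqP p n; rewrite mul1n.
  apply: (@leq_trans (q ^ (n - p) + q ^ (n - p))); first by rewrite leq_add2l.
  by rewrite addnn -mul2n expn_double // p0.
case: K => [|K]; first by rewrite big_ord0.
by rewrite rec leq_mul2l mul2n -addnn leq_add2l weak orbT.
Qed.

(** Rescaled form of: the sum of deg P q^(-2 deg P) over deg P <= n is at most 1 - q^(-n). The spare
    q^(-n) carries the induction: degree n + 1 adds at most q^(-n-1), and 2 q^(-n-1) <= q^(-n). *)
Lemma sum_pdeg_inv_sqr n :
  (\sum_(P <- prime_polys F n) pdeg P * q ^ (2 * n - 2 * pdeg P) + q ^ n <= q ^ (2 * n))%N.
Proof.
elim: n => [|n IH].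
  by rewrite big_seq big1 // => P /prime_polysP[_ _ _]; lia.
rewrite (bigID (fun P => pdeg P <= n)%N) /= -sum_prime_polys_le //.
have -> : (\sum_(P <- prime_polys F n) pdeg P * q ^ (2 * n.+1 - 2 * pdeg P) =
   q ^ 2 * \sum_(P <- prime_polys F n) pdeg P * q ^ (2 * n - 2 * pdeg P))%N.
  rewrite big_distrr /= big_seq [RHS]big_seq; apply: eq_bigr => P /prime_polysP[_ _ _ dP].
  by rewrite mulnCA -expnD; congr (_ * q ^ _)%N; lia.
have top : (\sum_(P <- prime_polys F n.+1 | ~~ (pdeg P <= n)) pdeg P * q ^ (2 * n.+1 - 2 * pdeg P)
    <= q ^ n.+1)%N.
  apply: leq_trans (sum_pdeg_primes_eq F n.+1 n.+1).
  rewrite big_seq_cond [leqRHS]big_seq_cond; apply: eq_leq; apply: eq_big => P.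
    by have [/prime_polysP[_ _ _]|//] := boolP (P \in _); lia.
  case/andP=> /prime_polysP[_ _ _ dP] nP.
  by rewrite (_ : 2 * n.+1 - 2 * pdeg P = 0)%N ?muln1 //; lia.
move: top; set T := (\sum_(P <- prime_polys F n.+1 | _) _)%N => top.
have -> : (2 * n.+1 = 2 + 2 * n)%N by lia.
rewrite expnD; move: IH top; set W := (\sum_(P <- prime_polys F n) _)%N.
rewrite expnS -mulnn.
move: q q_gt1 (q ^ n)%N (q ^ (2 * n))%N T => a a1 x y T WT Tx.
have h1 : (a * a * (W + x) <= a * a * y)%N by rewrite leq_mul2l WT orbT.
have h2 : (2 * (a * x) <= a * (a * x))%N by rewrite leq_mul2r a1 orbT.
by rewrite mulnDr -[(a * a * x)%N]mulnA in h1; lia.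
Qed.

Lemma sum_pdeg_inv_sqr_leq n :
  (\sum_(P <- prime_polys F n) (2 * pdeg P <= n)%N * (pdeg P * q ^ (n - 2 * pdeg P)) <= q ^ n)%N.
Proof.
pose h := n./2; have hn : (h <= n)%N by rewrite /h; lia.
rewrite (bigID (fun P => pdeg P <= h)%N) /= [X in (_ + X)%N]big1 => [|P]; last first.
  by rewrite /h => nP; rewrite (_ : (2 * pdeg P <= n)%N = false) //; lia.
rewrite addn0 -sum_prime_polys_le //.
apply: (@leq_trans (q ^ (n - 2 * h) *
    (\sum_(P <- prime_polys F h) pdeg P * q ^ (2 * h - 2 * pdeg P)))%N).
  rewrite big_distrr /= big_seq [leqRHS]big_seq; apply: leq_sum => P /prime_polysP[_ _ _ dP].
  rewrite [leqRHS]mulnCA -expnD (_ : (2 * pdeg P <= n)%N = true) ?mul1n; last first.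
    by rewrite /h in dP; lia.
  have -> : (n - 2 * h + (2 * h - 2 * pdeg P) = n - 2 * pdeg P)%N by rewrite /h in dP *; lia.
  by [].
rewrite -[X in (_ <= q ^ X)%N](_ : n - 2 * h + 2 * h = n)%N; last by rewrite /h; lia.
rewrite expnD leq_mul2l; apply/orP; right; apply: leq_trans (sum_pdeg_inv_sqr h).
exact: leq_addr.
Qed.

End GeometricSums.

(** * Prime factors of the values along a progression *)

Section LowerBound.
Variables (F : finFieldType) (f : {poly {poly F}}).
Local Notation q := #|F|.
Local Notation d := (size f).-1.
Implicit Types P : {poly F}.

Lemma sum_multiples_leq (J p B : nat) : (0 < p)%N ->
  (\sum_(k < J) (k.+1 * p <= B)%N * p <= B)%N.
Proof.
move=> p0; rewrite -big_distrl /=; apply: leq_trans (leq_trunc_div B p).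
rewrite leq_mul2r; apply/orP; right.
rewrite (eq_bigr (fun k : 'I_J => (k < B %/ p)%N : nat)) => [|k _]; last first.
  by rewrite leq_divRL.
elim: J => [|J IH]; first by rewrite big_ord0.
rewrite big_ord_recr /=; have [JB|JB] := ltnP J (B %/ p); last by rewrite addn0.
rewrite addn1; apply: leq_ltn_trans JB; rewrite -[leqRHS]card_ord -sum1_card.
by apply: leq_sum => k _; case: (_ < _)%N.
Qed.

Variables (Q0 M : {poly F}) (m B : nat).
Local Notation Qy y := (Q0 + M * monic_of y).
Hypothesis vals : forall y : {poly_m F}, f.[Qy y] != 0 /\ (pdeg f.[Qy y] <= B)%N.

Definition ndvd P k := #|[pred y : {poly_m F} | (P ^+ k.+1 %| f.[Qy y])%R]|.

(** The case k = 0 gives the first term. For k >= 1, powers of degree above B divide no value, and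
    the others divide at most d (1 + q^(m - (k+1) deg P)) values, the power of q being dropped if
    its exponent is negative. The ones add up to d B, the rest is a geometric series. *)
Lemma small_prime_contribution P : P \is monic -> irreducible_poly P ->
  hensel_prime f P -> ~~ (P %| M) -> (pdeg P <= m)%N ->
  (\sum_(k < B) ndvd P k * pdeg P <=
    nroots_mod f P * pdeg P * q ^ (m - pdeg P) + d * B +
    2 * d * ((2 * pdeg P <= m)%N * (pdeg P * q ^ (m - 2 * pdeg P))))%N.
Proof.
move=> mP irrP hP nPM Pm; have p0 := irredp_deg_gt0 irrP.
have nr : (nroots_mod f P <= d)%N by apply: nroots_mod_leq => //; case: hP.
have bnd k : (ndvd P k <= nroots_mod f P * q ^ (m - k.+1 * pdeg P))%N.
  exact: card_hensel_leq.
have zero k : (B < k.+1 * pdeg P)%N -> ndvd P k = 0%N.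
  move=> Bk; apply: eq_card0 => y; rewrite inE; apply/negbTE/negP => dv.
  have [fy0 fyB] := vals y.
  by have := leq_trans (dvdp_pow_deg fy0 dv) fyB; rewrite leqNgt Bk.
have sB1 := sum_multiples_leq B.-1 B p0.
have sB2 := geom_step_leq F B.-1 (m - pdeg P) p0.
have [B0|B_gt0] := posnP B.
  by rewrite big1 // => k _; have := ltn_ord k; rewrite {2}B0.
rewrite -(big_mkord xpredT (fun k => ndvd P k * pdeg P)%N) big_ltn // big_add1 big_mkord.
rewrite -addnA; apply: leq_add.
  by rewrite mulnAC leq_mul2r (leq_trans (bnd 0%N)) ?orbT // mul1n.
apply: (@leq_trans (\sum_(k < B.-1) (d * ((k.+1 * pdeg P <= B)%N * pdeg P) +
   d * pdeg P * ((k.+1 * pdeg P <= m - pdeg P)%N * q ^ (m - pdeg P - k.+1 * pdeg P))))%N).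
  apply: leq_sum => k _.
  have [Bk|kB] := ltnP B (k.+2 * pdeg P); first by rewrite zero.
  have -> : (k.+1 * pdeg P <= B)%N by apply: leq_trans kB; rewrite leq_mul2r leqnSn orbT.
  rewrite mul1n [(d * pdeg P * _)%N]mulnAC -mulnDl leq_mul2r; apply/orP; right.
  apply: leq_trans (bnd k.+1) _; apply: leq_trans (leq_mul nr (leqnn _)) _.
  rewrite -[X in (_ <= X + _)%N]muln1 -mulnDr leq_mul2l; apply/orP; right.
  have -> : (m - pdeg P - k.+1 * pdeg P = m - k.+2 * pdeg P)%N by rewrite -subnDA -mulSn.
  have [km|km] := leqP (k.+1 * pdeg P) (m - pdeg P); first by rewrite mul1n leq_addl.
  by rewrite (_ : m - k.+2 * pdeg P = 0)%N // mulSn; lia.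
rewrite big_split /= -!big_distrr /=; apply: leq_add.
  by rewrite leq_mul2l sB1 orbT.
apply: leq_trans (leq_mul (leqnn _) sB2) _.
have -> : (pdeg P <= m - pdeg P)%N = (2 * pdeg P <= m)%N by lia.
have -> : (m - pdeg P - pdeg P = m - 2 * pdeg P)%N by lia.
by apply/eq_leq; move: (nat_of_bool _) (q ^ _)%N => x y; ring.
Qed.

(** For deg P > m each root modulo P^(k+1) is met by at most one of the q^m arguments, so at most d
    values are divisible by P^(k+1), and none unless it divides L. *)
Lemma large_prime_contribution P (L : {poly F}) : P \is monic -> irreducible_poly P ->
  hensel_prime f P -> ~~ (P %| M) -> (m < pdeg P)%N ->
  (forall y : {poly_m F}, f.[Qy y] %| L) ->
  (\sum_(k < B) ndvd P k * pdeg P <=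
     d * \sum_(k < B) (P ^+ k.+1 %| L)%R * pdeg P)%N.
Proof.
move=> mP irrP hP nPM Pm dvdL; rewrite big_distrr /=; apply: leq_sum => k _.
rewrite mulnA leq_mul2r; apply/orP; right.
have nr : (nroots_mod f P <= d)%N by apply: nroots_mod_leq => //; case: hP.
have [Pk|nPk] := boolP (P ^+ k.+1 %| L).
  rewrite muln1; apply: leq_trans nr; apply: leq_trans (card_hensel_leq Q0 m k irrP hP nPM) _.
  by rewrite (_ : m - k.+1 * pdeg P = 0)%N ?muln1 //; nia.
rewrite muln0 leqn0; apply/eqP/eq_card0 => y; rewrite inE; apply/negbTE.
by apply: contra nPk => Py; apply: dvdp_trans Py (dvdL y).
Qed.

(** The values are factored over three ranges: a prime dividing M occurs at most K times in a value,
    primes of degree above m are charged to deg L, and the others fall under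
    [small_prime_contribution]. *)
Lemma sum_pdeg_values_leq (L : {poly F}) (K C : nat) : M != 0 -> L != 0 ->
  (m <= B)%N ->
  (forall P, irreducible_poly P -> ~~ (P %| M) -> hensel_prime f P) ->
  (forall P (y : {poly_m F}), irreducible_poly P -> P %| M -> ~~ (P ^+ K.+1 %| f.[Qy y])) ->
  (forall y : {poly_m F}, f.[Qy y] %| L) ->
  (\sum_(P <- prime_polys F m | ~~ (P %| lead_coef f)%R)
     nroots_mod f P * pdeg P * q ^ (m - pdeg P) <= q ^ m * (m + C))%N ->
  (\sum_(y : {poly_m F}) pdeg f.[Qy y] <=
     q ^ m * (K * pdeg M) + (d * pdeg L +
     (q ^ m * (m + C) + d * B * size (prime_polys F m) + 2 * d * q ^ m)))%N.
Proof.
move=> M0 L0 mB hens bad dvdL mertens.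
rewrite (eq_bigr (fun y => \sum_(P <- prime_polys F B) \sum_(k < B)
   (P ^+ k.+1 %| f.[Qy y])%R * pdeg P)%N) => [|y _]; last first.
  by have [fy0 fyB] := vals y; exact: pdeg_prime_powers.
rewrite (eq_bigr (fun y => \sum_(P <- prime_polys F B | (P %| M)%R) \sum_(k < B)
   (P ^+ k.+1 %| f.[Qy y])%R * pdeg P + \sum_(P <- prime_polys F B | ~~ (P %| M)%R)
   \sum_(k < B) (P ^+ k.+1 %| f.[Qy y])%R * pdeg P)%N) => [|y _]; last first.
  by rewrite (bigID (fun P => P %| M)).
rewrite big_split /=; apply: leq_add.
  rewrite -(card_npoly F m) -sum_nat_const; apply: leq_sum => y _.
  apply: (@leq_trans (\sum_(P <- prime_polys F B | (P %| M)%R) K * pdeg P)).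
    rewrite big_seq_cond [leqRHS]big_seq_cond; apply: leq_sum => P.
    case/andP=> /prime_polysP[_ irrP _ _] PM; rewrite -big_distrl leq_mul2r /=.
    apply/orP; right.
    rewrite -[leqRHS]card_ord -sum1_card.
    have [BK|KB] := leqP B K.
      rewrite (big_ord_widen K (fun k => (P ^+ k.+1 %| f.[Qy y])%R : nat) BK) big_mkcond /=.
      by apply: leq_sum => k _; case: ifP => // _; case: (_ %| _).
    rewrite (big_ord_widen B (fun=> 1%N) (ltnW KB)) [leqRHS]big_mkcond /=.
    apply: leq_sum => k _; case: ltnP => [_|Kk]; first by case: (_ %| _).
    rewrite leqn0 eqb0; apply: contra (bad P y irrP PM) => dv.
    by apply: dvdp_trans dv; apply: dvdp_exp2l.
  rewrite -big_distrr leq_mul2l /=; apply/orP; right.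
  exact: (sum_prime_dvd_le B xpredT M0).
rewrite exchange_big /=.
rewrite (eq_bigr (fun P => \sum_(k < B) ndvd P k * pdeg P)%N) => [|P _]; last first.
  rewrite exchange_big; apply: eq_bigr => k _; rewrite -big_distrl /=; congr (_ * _)%N.
  by rewrite /ndvd -sum1_card [RHS]big_mkcond; apply: eq_bigr => y _; rewrite inE; case: (_ %| _).
rewrite (bigID (fun P => pdeg P <= m)%N) /= addnC; apply: leq_add.
  apply: leq_trans (leq_mul (leqnn d) (pdeg_prime_powers_le B B
    (fun P => ~~ (P %| M)%R && ~~ (pdeg P <= m)%N) L0)).
  rewrite big_distrr /= big_seq_cond [leqRHS]big_seq_cond; apply: leq_sum => P.
  case/andP=> /prime_polysP[mP irrP _ _] /andP[nPM nPm].
  by apply: large_prime_contribution => //; [exact: hens|rewrite ltnNge].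
pose G P := ((~~ (P %| lead_coef f)%R) * (nroots_mod f P * pdeg P * q ^ (m - pdeg P)) + d * B +
    2 * d * ((2 * pdeg P <= m)%N * (pdeg P * q ^ (m - 2 * pdeg P))))%N.
apply: (@leq_trans (\sum_(P <- prime_polys F m) G P)%N).
  rewrite (sum_prime_polys_le G mB) big_mkcondl /=.
  rewrite big_seq_cond [leqRHS]big_seq_cond; apply: leq_sum => P.
  case/andP=> /prime_polysP[mP irrP _ _] Pm; case: ifP => // nPM.
  have hP := hens P irrP nPM.
  by rewrite /G (proj1 hP) mul1n; apply: small_prime_contribution.
rewrite /G !big_split /=; apply: leq_add; first apply: leq_add.
- by apply: leq_trans mertens; rewrite [leqRHS]big_mkcond /=; apply: leq_sum => P _;
    case: (~~ _); rewrite ?mul1n.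
- by rewrite big_const_seq count_predT iter_addn_0.
- by rewrite -big_distrr leq_mul2l sum_pdeg_inv_sqr_leq orbT.
Qed.

End LowerBound.

(** * Lower bound for the lcm and comparison with its radical *)

Section DegreeOfLcm.
Variables (F : finFieldType) (f : {poly {poly F}}).
Local Notation q := #|F|.
Local Notation d := (size f).-1.
Hypothesis irrf : irreducible_elt f.
Hypothesis d_gt1 : (1 < d)%N.

Let d_gt0 : (0 < d)%N := ltnW d_gt1.

Lemma monic_progression (Q0 M : {poly F}) m (y : {poly_m F}) : M \is monic ->
  (pdeg Q0 < pdeg M + m)%N ->
  exists z : {poly_(pdeg M + m) F}, Q0 + M * monic_of y = monic_of z.
Proof.
move=> mM Q0M; have M0 := monic_neq0 mM; have y0 := monic_neq0 (monic_of_monic y).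
have sMy : size (M * monic_of y) = (pdeg M + m).+1.
  by rewrite size_mul // size_monic_of addnS /= {1}(polySpred M0) addSn.
have sQ : (size Q0 < size (M * monic_of y)%R)%N by rewrite sMy; slia.
apply: monic_of_surj; last by rewrite /pdeg addrC size_polyDl // sMy.
rewrite monicE addrC lead_coefDl // lead_coefM (monicP mM) mul1r.
by have /monicP-> := monic_of_monic y.
Qed.

(** Here x is q^m. Of the main term, at least 2 n x, the Mertens sum takes n x, the prime count t at
    most n x / 2 and the constants at most n x / 4, which leaves n x / 4 <= dd l. *)
Lemma lower_bound_arith (x n m l dd c1 c2 t : nat) : (1 < dd)%N -> (4 * (c1 + c2) <= n)%N ->
  (m <= n)%N -> (2 * t <= n * x)%N ->
  (x * (dd * n) <= x * c1 + (dd * l + (x * (m + c2) + t)))%N ->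
  (x * n <= 4 * dd * l)%N.
Proof.
move=> d1 cn mn tn main.
have h1 : (x * (m + c2) <= x * (n + c2))%N by rewrite leq_mul2l leq_add2r mn orbT.
have h2 : (x * (2 * n) <= x * (dd * n))%N by rewrite !leq_mul2l leq_mul2r d1 !orbT.
have h3 : (x * (4 * (c1 + c2)) <= x * n)%N by rewrite leq_mul2l cn orbT.
nia.
Qed.

(* Working in the residue class of Q0 modulo M freezes the valuations of f at
   the finitely many primes where Hensel lifting fails. *)
Lemma lcm_degree_lower_bound : exists c N : nat, (0 < c)%N /\
  forall n (L : {poly F}), (N <= n)%N -> L != 0 ->
    (forall y : {poly_n F}, f.[monic_of y] %| L) -> (n * q ^ n <= c * pdeg L)%N.
Proof.
have f0 : f != 0 by case: irrf.
have [a fa] := coef_size_bound f.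
have [D D0 hens] := almost_all_hensel irrf d_gt0.
have [C0 mertens] := sum_nroots_leq irrf d_gt0.
pose D' := (lead_coef D)^-1 *: D.
have lD0 : (lead_coef D)^-1 != 0 by rewrite invr_eq0 lead_coef_eq0.
have mD : D' \is monic by rewrite monicE lead_coefZ mulVf // lead_coef_eq0.
pose Q0 : {poly F} := 'X^(a.+1); have sQ0 : size Q0 = a.+2 by rewrite size_polyXn.
have [fQ0 _] := pdeg_value_geq fa f0 (ltnSn a) sQ0.
(* By degree no P^(K+1) divides f(Q0). A prime factor of M occurs in M at least K + 1 times, so
   P^(K+1) divides no value at an argument congruent to Q0 modulo M either. *)
pose K := pdeg f.[Q0]; pose M := D' ^+ K.+1; pose s := pdeg M.
have mM : M \is monic by rewrite monic_exp.
have hensM P : irreducible_poly P -> ~~ (P %| M) -> hensel_prime f P.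
  move=> irrP nPM; apply: hens => //; apply: contra nPM => PD.
  by rewrite /M exprS dvdp_mulr // /D' dvdpZr.
have bad m P (y : {poly_m F}) : irreducible_poly P -> P %| M ->
    ~~ (P ^+ K.+1 %| f.[Q0 + M * monic_of y]).
  move=> irrP /(irredp_prime_pow irrP) PD; apply/negP => dv.
  have PM : P ^+ K.+1 %| M by rewrite dvdp_exp2r.
  have : P ^+ K.+1 %| f.[Q0].
    rewrite -(dvdp_subr _ dv); apply: dvdp_trans (dvd_horner_sub _ _ _).
    by rewrite addrAC subrr add0r dvdp_mulr.
  by move/(dvdp_pow_deg fQ0); have := irredp_deg_gt0 irrP; rewrite -/K; nia.
(* As B <= (a + d) n, this e keeps d B times the number of primes of degree at most m below n q^m /
   2. *)
pose e := (2 * (d * (a + d)))%N; have [N1 HN1] := prime_polys_negligible F e.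
(* The factor q^s is the loss from using only q^(n - s) of the q^n values. *)
exists (4 * d * q ^ s)%N, (s + N1 + a.+2 + 4 * (K * s + (C0 + 2 * d)))%N.
have q0 : (0 < q)%N by rewrite ltnW ?card_field_gt1.
split; first by rewrite !muln_gt0 d_gt0 expn_gt0 q0.
move=> n L Nn L0 dvdL; pose m := (n - s)%N.
have nE : n = (s + m)%N by rewrite /m; lia.
have prog (y : {poly_m F}) : exists z : {poly_n F}, Q0 + M * monic_of y = monic_of z.
  rewrite nE; apply: monic_progression => //; rewrite -nE /pdeg sQ0 /=; lia.
have an : (a < n)%N by lia.
pose B := (a + d * n)%N.
have vals (y : {poly_m F}) : f.[Q0 + M * monic_of y] != 0 /\
    (pdeg f.[Q0 + M * monic_of y] <= B)%N.
  have [z ->] := prog y; split; first by have [] := pdeg_value_geq fa f0 an (size_monic_of z).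
  by apply: (pdeg_value_leq fa); rewrite size_monic_of.
have mB : (m <= B)%N by rewrite /B /m; nia.
have dvdL' (y : {poly_m F}) : f.[Q0 + M * monic_of y] %| L.
  by have [z ->] := prog y.
have := sum_pdeg_values_leq vals (monic_neq0 mM) L0 mB hensM (@bad m) dvdL' (mertens m).
rewrite -/s => upper.
have lower : (q ^ m * (d * n) <= \sum_(y : {poly_m F}) pdeg f.[(Q0 + M * monic_of y)%R])%N.
  rewrite -(card_npoly F m) -sum_nat_const; apply: leq_sum => y _.
  by have [z ->] := prog y; have [] := pdeg_value_geq fa f0 an (size_monic_of z).
have cnt : (e * size (prime_polys F m) <= q ^ m)%N by apply: HN1; rewrite /m; lia.
have small : (2 * (d * B * size (prime_polys F m)) <= n * q ^ m)%N.
  apply: leq_trans (leq_mul (leqnn n) cnt).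
  have Bn : (B <= (a + d) * n)%N by rewrite /B; nia.
  have -> : (n * (e * size (prime_polys F m)) =
    2 * (d * ((a + d) * n) * size (prime_polys F m)))%N by rewrite /e; ring.
  by rewrite leq_mul2l leq_mul2r leq_mul2l Bn !orbT.
have main : (q ^ m * n <= 4 * d * pdeg L)%N.
  apply: (@lower_bound_arith _ _ m _ d (K * s) (C0 + 2 * d) (d * B * size (prime_polys F m))) => //.
  - by lia.
  - by rewrite /m leq_subr.
  apply: leq_trans lower (leq_trans upper _); rewrite !leq_add2l.
  by apply: eq_leq; move: (q ^ m)%N d => x y; ring.
have -> : (q ^ n = q ^ s * q ^ m)%N by rewrite -expnD -nE.
rewrite mulnCA [(n * _)%N]mulnC [(4 * d * q ^ s)%N]mulnC -mulnA leq_mul2l.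
by rewrite main orbT.
Qed.

Lemma lcm_values_neq0 n : (forall y : {poly_n F}, f.[monic_of y] != 0) ->
  lcm_values f n != 0.
Proof.
move=> nz; have : lcm_values f n %| \prod_(y : {poly_n F}) f.[monic_of y].
  apply/lcm_values_dvd => Q mQ dQ; have [y ->] := monic_of_surj mQ dQ.
  by rewrite (bigD1 y) //= dvdp_mulr.
by move/dvdpN0; apply; apply/prodf_neq0 => y _.
Qed.

Lemma value_dvd_lcm n (y : {poly_n F}) : f.[monic_of y] %| lcm_values f n.
Proof.
have /lcm_values_dvd := dvdpp (lcm_values f n).
by apply; [exact: monic_of_monic | exact: pdeg_monic_of].
Qed.

(** If P^(k+1) divided no value, L / P would still be a common multiple of the values. *)
Lemma prime_power_dvd_lcm n (P : {poly F}) k : irreducible_poly P ->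
  lcm_values f n != 0 -> P ^+ k.+1 %| lcm_values f n ->
  exists y : {poly_n F}, P ^+ k.+1 %| f.[monic_of y].
Proof.
set L := lcm_values f n => irrP L0 PL.
have P0 : P != 0 by apply/eqP => P0; have := irrP.1; rewrite P0 size_poly0.
have [/existsP //|/existsPn no] := boolP [exists y : {poly_n F}, P ^+ k.+1 %| f.[monic_of y]].
have PL1 : P %| L by apply: dvdp_trans PL; rewrite exprS dvdp_mulr.
have : L %| L %/ P.
  apply/lcm_values_dvd => Q mQ dQ; have [y ->] := monic_of_surj mQ dQ.
  have := value_dvd_lcm y; rewrite -/L => /dvdpP[h LE].
  have Ph : P %| h.
    apply: contraNT (no y) => nPh.
    have cop : coprimep (P ^+ k.+1) h.
      by rewrite coprimep_expl // irreducible_poly_coprime.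
    by rewrite -(Gauss_dvdpr _ cop) -LE.
  by rewrite LE -(divpK Ph) mulrAC mulpK // dvdp_mull.
have LP0 : L %/ P != 0 by apply: contraNneq L0 => LP0; rewrite -(divpK PL1) LP0 mul0r.
have dL : pdeg L = (pdeg (L %/ P) + pdeg P)%N by rewrite -[in LHS](divpK PL1) pdegM.
by move/(pdeg_dvd LP0); have := irredp_deg_gt0 irrP; lia.
Qed.

Lemma pdeg_rad (A : {poly F}) : A != 0 ->
  pdeg (Defs.rad A) = (\sum_(P <- prime_polys F (pdeg A) | (P %| A)%R) pdeg P)%N.
Proof.
move=> A0; have sA : size A = (pdeg A).+1 by rewrite /pdeg -polySpred.
rewrite /Defs.rad pdeg_prod => [|P /and3P[mP _ _]]; last exact: monic_neq0.
rewrite sA /prime_polys big_map big_filter_cond big_enum_cond /=.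
by apply: eq_bigl => P; rewrite andbA.
Qed.

(** A prime with P^2 not dividing L counts equally in L and in its radical. Any other takes up at
    most a + d n, since its highest power in L divides a single value. *)
Lemma pdeg_lcm_leq (a n : nat) : (forall i, size (f`_i)%R <= a.+1)%N -> (a < n)%N ->
  (pdeg (lcm_values f n) <= pdeg (rad_lcm_values f n) + (a + d * n) *
    (size (prime_polys F n) + count (fun P => (n < pdeg P)%N &&
     [exists y : {poly_n F}, (P ^+ 2 %| f.[monic_of y])%R])
       (prime_polys F (pdeg (lcm_values f n)))))%N.
Proof.
move=> fa an; have f0 : f != 0 by case: irrf.
have nz (y : {poly_n F}) : f.[monic_of y] != 0.
  by have [] := pdeg_value_geq fa f0 an (size_monic_of y).
have L0 := lcm_values_neq0 nz; rewrite /rad_lcm_values pdeg_rad //.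
have PL := prime_power_dvd_lcm _ L0.
set L := lcm_values f n in L0 PL *; set B := (a + d * n)%N.
have exps (P : {poly F}) k : irreducible_poly P -> P ^+ k.+1 %| L -> (k.+1 * pdeg P <= B)%N.
  move=> irrP /(PL _ _ irrP)[y Py]; apply: leq_trans (dvdp_pow_deg (nz y) Py) _.
  by apply: (pdeg_value_leq fa); rewrite size_monic_of.
pose ps := prime_polys F (pdeg L).
have cnt2 : (count (fun P => (P ^+ 2 %| L)%R) ps <= size (prime_polys F n) +
   count (fun P => (n < pdeg P)%N &&
     [exists y : {poly_n F}, (P ^+ 2 %| f.[monic_of y])%R]) ps)%N.
  have -> : count (fun P => (P ^+ 2 %| L)%R) ps =
     (count (predI (fun P => (P ^+ 2 %| L)%R) (fun P => pdeg P <= n)%N) ps +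
     count (predI (fun P => (P ^+ 2 %| L)%R) (fun P => n < pdeg P)%N) ps)%N.
    rewrite -!sum1_count /= [LHS](bigID (fun P => pdeg P <= n)%N) /=; congr (_ + _)%N.
    by apply: eq_bigl => P; rewrite ltnNge.
  apply: leq_add.
    rewrite -size_filter; apply: uniq_leq_size; first by rewrite filter_uniq ?prime_polys_uniq.
    move=> P; rewrite mem_filter !mem_prime_polys /= => /andP[/andP[_ ->]].
    by case/and3P=> -> ->.
  rewrite -!size_filter; apply: uniq_leq_size; first by rewrite filter_uniq ?prime_polys_uniq.
  move=> P; rewrite !mem_filter /= => /andP[/andP[P2 ->] Pps]; rewrite Pps andbT.
  by apply/existsP; have /prime_polysP[_ irrP _ _] := Pps; exact: PL irrP P2.
apply: leq_trans (leq_add (leqnn _) (leq_mul (leqnn B) cnt2)).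
rewrite {1}(pdeg_prime_powers L0 (leqnn _) (leqnn _)) -/ps -sum1_count big_distrr /=.
rewrite [X in (_ <= X + _)%N]big_mkcond [X in (_ <= _ + X)%N]big_mkcond -big_split /=.
rewrite big_seq [leqRHS]big_seq; apply: leq_sum => P /prime_polysP[_ irrP _ dP].
have p0 := irredp_deg_gt0 irrP.
have [P2|nP2] := boolP (P ^+ 2 %| L).
  apply: leq_trans (leq_addl _ _); rewrite muln1.
  apply: leq_trans (sum_multiples_leq (pdeg L) B p0); apply: leq_sum => k _.
  rewrite leq_mul2r; apply/orP; right.
  by case: (boolP (_ %| _)) => // /(exps _ _ irrP) ->.
rewrite addn0 -(big_mkord xpredT (fun k => (P ^+ k.+1 %| L)%R * pdeg P)%N).
rewrite big_ltn; last by lia.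
rewrite big_nat_cond big1 => [|k /andP[/andP[k1 _] _]]; last first.
  case: (boolP (_ %| _)) => // dv; case/negP: nP2; apply: dvdp_trans dv.
  exact: dvdp_exp2l.
by rewrite addn0 expr1; case: (P %| L); rewrite ?mul1n.
Qed.

Lemma rad_deficit_negligible (e : nat) : exists N, forall n, (N <= n)%N ->
  [/\ (0 < pdeg (lcm_values f n))%N,
      (pdeg (rad_lcm_values f n) <= pdeg (lcm_values f n))%N &
      (e * (pdeg (lcm_values f n) - pdeg (rad_lcm_values f n)) <=
        pdeg (lcm_values f n))%N].
Proof.
have f0 : f != 0 by case: irrf.
have [a fa] := coef_size_bound f.
have [c [N1 [c0 lower]]] := lcm_degree_lower_bound.
(* The 2 serves the two families of excess primes, c the lower bound for deg L, and (a + d) n bounds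
   the share of one prime. *)
pose e1 := (2 * (e * c * (a + d)))%N.
have [N2 HN2] := prime_polys_negligible F e1.
have [N3 HN3] := square_divisors_negligible irrf d_gt0 e1.
exists (a.+1 + N1 + N2 + N3)%N => n Nn.
have an : (a < n)%N by lia.
have nz (y : {poly_n F}) : f.[monic_of y] != 0.
  by have [] := pdeg_value_geq fa f0 an (size_monic_of y).
have L0 := lcm_values_neq0 nz.
have upper := pdeg_lcm_leq fa an.
have {}lower : (n * q ^ n <= c * pdeg (lcm_values f n))%N.
  by apply: lower => //; [lia | exact: value_dvd_lcm].
have q0 : (0 < q ^ n)%N by rewrite expn_gt0 ltnW ?card_field_gt1.
have h2 : (e1 * size (prime_polys F n) <= q ^ n)%N by apply: HN2; lia.
have h3 := HN3 n (pdeg (lcm_values f n)).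
have {}h3 := h3 ltac:(lia).
split.
- rewrite lt0n; apply: contraTneq lower => ->; rewrite muln0 -ltnNge muln_gt0 q0 andbT; lia.
- rewrite /rad_lcm_values pdeg_rad //; exact: (sum_prime_dvd_le _ xpredT L0).
move: upper h2 h3 lower; rewrite /e1.
set b := pdeg (lcm_values f n); set r := pdeg (rad_lcm_values f n).
move: (size _) (count _ _) (q ^ n)%N q0 d => u v x x0 k upper h2 h3 lower.
have br : (b - r <= (a + k) * n * (u + v))%N.
  rewrite leq_subLR; apply: leq_trans upper _; rewrite leq_add2l leq_mul2r; apply/orP; right.
  by nia.
rewrite -(leq_pmul2l c0); apply: leq_trans lower.
have h4 : (e * c * (a + k) * (u + v) <= x)%N by lia.
have h5 := leq_mul (leqnn n) h4.
apply: leq_trans h5.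
rewrite mulnA [(c * e)%N]mulnC; apply: leq_trans (leq_mul (leqnn _) br) _.
by apply: eq_leq; ring.
Qed.

End DegreeOfLcm.

Theorem theorem1p5 (R : realType) (F : finFieldType) (f : {poly {poly F}})
    (hirr : irreducible_elt f) (hdeg : (2 <= (size f).-1)%N) :
  asymp_equiv R (fun n => pdeg (rad_lcm_values f n))
                (fun n => pdeg (lcm_values f n)).
Proof.
apply/cvgrPdist_le => eps eps0.
(* As e > 1 / eps, a deficit of at most deg L / e is a relative error of at most eps. *)
pose e := (Num.truncn eps^-1).+1.
have e_eps : 1 <= eps * e%:R.
  by rewrite -ler_pdivrMl // mulr1 ltW // truncnS_gt.
have [N HN] := rad_deficit_negligible hirr hdeg e.
exists N => // n /= /HN[].
move: (pdeg (lcm_values f n)) (pdeg (rad_lcm_values f n)) => b a b0 ab eb.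
have b0' : 0 < b%:R :> R by rewrite ltr0n.
have -> : 1 - a%:R / b%:R = (b - a)%:R / b%:R :> R.
  by rewrite natrB // mulrBl divff ?gt_eqF.
rewrite ger0_norm ?divr_ge0 ?ler0n // ler_pdivrMr //.
have : e%:R * (b - a)%:R <= b%:R :> R by rewrite -natrM ler_nat.
move=> H; apply: le_trans (ler_wpM2l (ltW eps0) H); rewrite mulrA.
by rewrite ler_peMl ?ler0n.
Qed.
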